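(* In the contextual MNL model and for the occasional online-mirror-descent updates described in the context, let $\delta\in(0,1]$ and let $\mathcal{T}\subseteq[T]$ denote the set of update rounds. Assume that for all $t\in\mathcal{T}$ $$\sup_{\mathbf{w}\in\mathcal{W}_t}|x_{ti}^\top(\mathbf{w}-\mathbf{w}^\star)|\le\alpha\qquad\forall i\in S_t ,$$ where $\mathcal{W}_t\subseteq\mathbb{R}^d$ is a compact convex set and $\alpha>0$. Set $\eta=(1+3\sqrt2\,\alpha)/2$ and $\lambda=\max\{72\eta\alpha,\;144\eta d,\;2\}$. Assume $\|x_{ti}\|_2\le 1$ and $r_{ti}\in[0,1]$ for all $t\ge1$, $i\in[N]$, and $\|\mathbf{w}^\star\|_2\le B$ for a known constant $B$. Then, with probability at least $1-\delta$, for all $t\in\mathcal{T}$, $$\|\mathbf{w}_t-\mathbf{w}^\star\|_{H_t}=O\left(\alpha\sqrt{d\log(t/\delta)}+B\sqrt{\lambda}\right).$$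
   Context: Notation: $\|x\|_A=\sqrt{x^\top Ax}$, $\mathbf{I}_d$ is the identity, and $O(\cdot)$ hides constant factors. MNL model. There are $T$ rounds, $N$ items and a maximal assortment size $K$. At round $t$, feature vectors $x_{ti}\in\mathbb{R}^d$ and rewards $r_{ti}$, $i\in[N]$, are revealed (they may be chosen arbitrarily by an adversary), the learner offers $S_t\subseteq[N]$ with $|S_t|\le K$, and a choice $c_t\in S_t\cup\{0\}$ is observed ($0$ is the outside option, $x_{t0}=\mathbf{0}$); $y_{ti}=\mathbb{1}(c_t=i)$. The choice $c_t=i$ has probability $p_t(i\mid S_t,\mathbf{w}^\star)$, where for $i\in S\cup\{0\}$ $$p_t(i\mid S,\mathbf{w})=\frac{\exp(x_{ti}^\top\mathbf{w})}{1+\sum_{j\in S}\exp(x_{tj}^\top\mathbf{w})},$$ and $\mathbf{w}^\star\in\mathbb{R}^d$ is unknown. The loss of round $t$ is $\ell_t(\mathbf{w})=-\sum_{i\in S_t\cup\{0\}}y_{ti}\log p_t(i\mid S_t,\mathbf{w})$. Updates. The search space $\mathcal{W}_t$ is possibly time-varying, and the parameter is updated only at rounds $t\in\mathcal{T}$. The initial point satisfies $\|\mathbf{w}_1\|_2\le B$. Let $H_t=\lambda\mathbf{I}_d+\sum_{s\in\mathcal{T},\,s<t}\nabla^2\ell_s(\mathbf{w}_{s+1})$. At $t\in\mathcal{T}$: $$\mathbf{w}_t'=\arg\min_{\mathbf{w}\in\mathcal{W}_t}\|\mathbf{w}-\mathbf{w}_t\|_{H_t},\qquad \mathbf{w}_{t+1}=\arg\min_{\mathbf{w}\in\mathcal{W}_t}\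 \langle\nabla\ell_t(\mathbf{w}_t'),\mathbf{w}\rangle+\frac1{2\eta}\|\mathbf{w}-\mathbf{w}_t'\|^2_{\tilde H_t},$$ with step size $\eta>0$ and $\tilde H_t=H_t+\eta\nabla^2\ell_t(\mathbf{w}_t')$. At $t\notin\mathcal{T}$, $\mathbf{w}_{t+1}=\mathbf{w}_t$ and $H_{t+1}=H_t$.
   Formalization: Two assumptions are added, without which the claim fails: w* lies in W_t for every update round t, and α is bounded below by some α₀ > 0, the constant hidden in O(·) depending only on α₀ (no constant is uniform as α → 0). *)

(* Defs.v *)
From HB Require Import structures.
From mathcomp Require Import all_boot all_order all_algebra.
From mathcomp Require Import all_classical all_reals all_analysis.
Set Implicit Arguments.
Unset Strict Implicit.
Unset Printing Implicit Defensive.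
Import Order.TTheory GRing.Theory Num.Theory.
Import numFieldNormedType.Exports.
Local Open Scope classical_set_scope.
Local Open Scope ring_scope.

(* [`|v|] on matrices is the sup norm in MathComp-Analysis, hence [norm2]. *)
Definition dotv (R : realType) (d : nat) (u v : 'cV[R]_d) : R :=
  (u^T *m v) 0 0.

Definition norm2 (R : realType) (d : nat) (v : 'cV[R]_d) : R :=
  Num.sqrt (\sum_(i < d) v i 0 ^+ 2).

Definition mxnorm (R : realType) (d : nat) (A : 'M[R]_d) (v : 'cV[R]_d) : R :=
  Num.sqrt ((v^T *m A *m v) 0 0).

Definition gradient (R : realType) (d : nat) (f : 'cV[R]_d -> R)
    (w : 'cV[R]_d) : 'cV[R]_d :=
  \col_(i < d) 'D_(delta_mx i 0) f w.

Definition hessian (R : realType) (d : nat) (f : 'cV[R]_d -> R)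
    (w : 'cV[R]_d) : 'M[R]_d :=
  \matrix_(i < d, j < d)
    'D_(delta_mx i 0) (fun v => 'D_(delta_mx j 0) f v) w.

Definition is_argmin (R : realType) (V : Type) (W : set V) (f : V -> R)
    (w : V) : Prop :=
  W w /\ forall v, W v -> f w <= f v.

(* A choice is [Some i] for the item [i] and [None] for the outside option,
   whose feature vector is 0.  The set S u {0} is [offered S]. *)
Definition feature (R : realType) (d N : nat) (x : 'I_N -> 'cV[R]_d)
    (o : option 'I_N) : 'cV[R]_d :=
  if o is Some i then x i else 0.

Definition offered (N : nat) (S : {set 'I_N}) (o : option 'I_N) : bool :=
  if o is Some i then i \in S else true.

Definition mnl_prob (R : realType) (d N : nat) (x : 'I_N -> 'cV[R]_d)
    (S : {set 'I_N}) (w : 'cV[R]_d) (o : option 'I_N) : R :=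
  expR (dotv (feature x o) w) / (1 + \sum_(j in S) expR (dotv (x j) w)).

Definition mnl_loss (R : realType) (d N : nat) (x : 'I_N -> 'cV[R]_d)
    (S : {set 'I_N}) (c : option 'I_N) (w : 'cV[R]_d) : R :=
  - \sum_(o | offered S o) (c == o)%:R * ln (mnl_prob x S w o).

(* [F t] is the information available once the choices of rounds 1, ..., t are
   known and everything that precedes the choice of round t.+1 has been drawn:
   the features, rewards and assortment of round t are [F t.-1]-measurable. *)
Definition filtration (disp : measure_display) (Omega : measurableType disp)
    (F : nat -> set (set Omega)) : Prop :=
  [/\ forall t, sigma_algebra setT (F t),
      forall t, F t `<=` measurable
    & forall s t, (s <= t)%N -> F s `<=` F t].

Definition meas_real (R : realType) (Omega : Type) (G : set (set Omega))
    (f : Omega -> R) : Prop :=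
  forall A : set R, measurable A -> G (f @^-1` A).

Definition meas_vec (R : realType) (Omega : Type) (G : set (set Omega))
    (d : nat) (f : Omega -> 'cV[R]_d) : Prop :=
  forall i, meas_real G (fun omega => f omega i 0).

Definition meas_discrete (Omega : Type) (G : set (set Omega)) (I : finType)
    (f : Omega -> I) : Prop :=
  forall a, G [set omega | f omega = a].

(* [q] is a version of the conditional probability P(E | G). *)
Definition is_cond_prob (disp : measure_display) (Omega : measurableType disp)
    (R : realType) (P : probability Omega R) (G : set (set Omega))
    (E : set Omega) (q : Omega -> R) : Prop :=
  meas_real G q /\
  forall A, G A -> P (A `&` E) = (\int[P]_(omega in A) (q omega)%:E)%E.

(* The contextual MNL model over the rounds 1, ..., T.  Being predictable, the
   features, rewards and assortments may depend in any way on the past, and on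
   any extra randomness of the adversary and of the learner. *)
Record mnl_model (disp : measure_display) (Omega : measurableType disp)
    (R : realType) (P : probability Omega R) (F : nat -> set (set Omega))
    (d N K T : nat) (x : nat -> Omega -> 'I_N -> 'cV[R]_d)
    (r : nat -> Omega -> 'I_N -> R) (S : nat -> Omega -> {set 'I_N})
    (c : nat -> Omega -> option 'I_N) (wstar : 'cV[R]_d) : Prop := {
  mnl_filtration : filtration F ;
  mnl_features_predictable : forall t, (1 <= t <= T)%N ->
    forall i, meas_vec (F t.-1) (fun omega => x t omega i) ;
  mnl_rewards_predictable : forall t, (1 <= t <= T)%N ->
    forall i, meas_real (F t.-1) (fun omega => r t omega i) ;
  mnl_assortment_predictable : forall t, (1 <= t <= T)%N ->
    meas_discrete (F t.-1) (S t) ;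
  mnl_assortment_card : forall t, (1 <= t <= T)%N ->
    forall omega, (#|S t omega| <= K)%N ;
  mnl_choice_adapted : forall t, (1 <= t <= T)%N ->
    meas_discrete (F t) (c t) ;
  mnl_choice_offered : forall t, (1 <= t <= T)%N ->
    forall omega, offered (S t omega) (c t omega) ;
  mnl_choice_law : forall t, (1 <= t <= T)%N -> forall o,
    is_cond_prob P (F t.-1) [set omega | c t omega = o]
      (fun omega => if offered (S t omega) o
                    then mnl_prob (x t omega) (S t omega) wstar o else 0)
}.

(* The next two definitions describe one trajectory: [U] is the set of update
   rounds, [ell t] the loss of round t, [w t] the iterates, [w' t] the
   projected iterates (constrained on update rounds only). *)
Definition omd_matrix (R : realType) (d : nat) (lambda : R) (U : nat -> bool)
    (ell : nat -> 'cV[R]_d -> R) (w : nat -> 'cV[R]_d) (t : nat) : 'M[R]_d :=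
  lambda%:M + \sum_(1 <= s < t | U s) hessian (ell s) (w s.+1).

Definition omd_step (R : realType) (d : nat) (eta lambda : R) (U : nat -> bool)
    (ell : nat -> 'cV[R]_d -> R) (W : nat -> set 'cV[R]_d)
    (w w' : nat -> 'cV[R]_d) (t : nat) : Prop :=
  let H := omd_matrix lambda U ell w t in
  let Htilde := H + eta *: hessian (ell t) (w' t) in
  if U t then
    is_argmin (W t) (fun v => mxnorm H (v - w t)) (w' t) /\
    is_argmin (W t)
      (fun v => dotv (gradient (ell t) (w' t)) v
                + (2 * eta)^-1 * mxnorm Htilde (v - w' t) ^+ 2)
      (w t.+1)
  else w t.+1 = w t.

(* Occasional online mirror descent.  Whether round t is an update round is
   decided before the choice of round t is observed.  The random sets [W t] are
   only required to be such that the iterates are random variables. *)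
Record occasional_omd (Omega : Type) (R : realType)
    (F : nat -> set (set Omega)) (d T : nat) (eta lambda B : R)
    (U : nat -> Omega -> bool) (ell : nat -> Omega -> 'cV[R]_d -> R)
    (W : nat -> Omega -> set 'cV[R]_d)
    (w w' : nat -> Omega -> 'cV[R]_d) : Prop := {
  omd_rounds : forall t omega, U t omega -> (1 <= t <= T)%N ;
  omd_rounds_predictable : forall t, (1 <= t <= T)%N ->
    meas_discrete (F t.-1) (U t) ;
  omd_iterates_adapted : forall t, (1 <= t <= T.+1)%N ->
    meas_vec (F t.-1) (w t) ;
  omd_projection_predictable : forall t, (1 <= t <= T)%N ->
    meas_vec (F t.-1) (w' t) ;
  omd_initial : forall omega, norm2 (w 1%N omega) <= B ;
  omd_update : forall t, (1 <= t <= T)%N -> forall omega,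
    omd_step eta lambda (U ^~ omega) (ell ^~ omega) (W ^~ omega)
      (w ^~ omega) (w' ^~ omega) t
}.

(* Main.v *)
Require Import Defs.
From mathcomp Require Import all_boot all_order all_algebra finmap.
From mathcomp Require Import all_classical all_reals all_analysis.
From mathcomp Require Import measurable_realfun ring lra.
Import Order.TTheory GRing.Theory Num.Theory.
Import numFieldNormedType.Exports.
Local Open Scope classical_set_scope.
Local Open Scope ring_scope.
Set Implicit Arguments.
Unset Strict Implicit.
Unset Printing Implicit Defensive.

(** Write [u] for the unknown parameter, [p_w] for the choice law at [w], [G] for the Hessian
    at the projected iterate [w'], [g_o] for the gradient there when [o] is chosen, and
    [z_o] for its squared dual norm with respect to [H].

    Optimality of the mirror step bounds [|w_{t+1} - u|^2_{H_{t+1}} - |w_t - u|^2_{H_t}] by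
    [- 2 eta <g_c, w' - u>] plus the squared norm of [w' - u] under [G] and errors of size
    [eta^2 z_c].  Put [s = alpha / (1 + alpha)] and [v = u + s (w' - u)].  Concavity of the
    log-likelihood at [v] yields [- <g_c, w' - u> <= ln (p_v(c) / p_u(c)) / s - J], where [J]
    is, up to a factor, the Jeffreys divergence of [p_w'] and [p_v].  It satisfies
    [J >= |w' - u|^2_G / (1 + 3 alpha)], and [2 eta > 1 + 3 alpha] leaves a slack of order [s]
    that pays for the errors.

    Hence the drift in a round is at most [2 eta / s] times [ln (p_v(c) / p_u(c)) + 2 eta z_c].
    Under [p_u] the expectation of [p_v(c) / p_u(c) * exp (2 eta z_c)] is that of
    [exp (2 eta z)] under [p_v], and [p_v <= e^2 p_w'], so subtracting a multiple of
    [tr (H^-1 G)] in the exponent gives a supermartingale, to which Ville's maximal inequality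
    applies.  The traces sum to [O(d ln t)] by the elliptical potential argument.

    [alpha0] enters because the slack [s] vanishes with [alpha]. *)

(** * Quadratic forms and determinants *)

Section Dot.
Variables (R : realType) (d : nat).
Implicit Types (u v w : 'cV[R]_d) (A B : 'M[R]_d).

Lemma dotvE u v : dotv u v = \sum_(i < d) u i 0 * v i 0.
Proof. by rewrite /dotv mxE; apply: eq_bigr => i _; rewrite mxE. Qed.

Lemma dotvC u v : dotv u v = dotv v u.
Proof. by rewrite !dotvE; apply: eq_bigr => i _; rewrite mulrC. Qed.

Lemma dotvDr u v w : dotv u (v + w) = dotv u v + dotv u w.
Proof. by rewrite /dotv mulmxDr mxE. Qed.

Lemma dotvDl u v w : dotv (u + v) w = dotv u w + dotv v w.
Proof. by rewrite dotvC dotvDr !(dotvC w). Qed.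

Lemma dotvZr a u v : dotv u (a *: v) = a * dotv u v.
Proof. by rewrite /dotv -scalemxAr mxE. Qed.

Lemma dotvZl a u v : dotv (a *: u) v = a * dotv u v.
Proof. by rewrite dotvC dotvZr dotvC. Qed.

Lemma dotvNr u v : dotv u (- v) = - dotv u v.
Proof. by rewrite -scaleN1r dotvZr mulN1r. Qed.

Lemma dotvNl u v : dotv (- u) v = - dotv u v.
Proof. by rewrite dotvC dotvNr dotvC. Qed.

Lemma dotvBr u v w : dotv u (v - w) = dotv u v - dotv u w.
Proof. by rewrite dotvDr dotvNr. Qed.

Lemma dotvBl u v w : dotv (u - v) w = dotv u w - dotv v w.
Proof. by rewrite dotvDl dotvNl. Qed.

Lemma dotv0l v : dotv 0 v = 0.
Proof. by rewrite -[0](scale0r 0) dotvZl mul0r. Qed.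

Lemma dotv0r v : dotv v 0 = 0.
Proof. by rewrite dotvC dotv0l. Qed.

Lemma dotv_sumr (I : finType) (P : pred I) (f : I -> 'cV[R]_d) u :
  dotv u (\sum_(i | P i) f i) = \sum_(i | P i) dotv u (f i).
Proof. exact: (big_morph _ (dotvDr u) (dotv0r u)). Qed.

Lemma dotv_suml (I : finType) (P : pred I) (f : I -> 'cV[R]_d) u :
  dotv (\sum_(i | P i) f i) u = \sum_(i | P i) dotv (f i) u.
Proof. by rewrite dotvC dotv_sumr; apply: eq_bigr => i _; rewrite dotvC. Qed.

Lemma dotv_ge0 v : 0 <= dotv v v.
Proof. by rewrite dotvE sumr_ge0 // => i _; rewrite -expr2 sqr_ge0. Qed.

Lemma norm2_sqr v : norm2 v ^+ 2 = dotv v v.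
Proof.
rewrite /norm2 sqr_sqrtr ?dotvE //; by rewrite sumr_ge0 // => i _; rewrite sqr_ge0.
Qed.

Lemma norm2_ge0 v : 0 <= norm2 v.
Proof. exact: sqrtr_ge0. Qed.

Lemma dotv_adj A u v : dotv u (A *m v) = dotv (A^T *m u) v.
Proof. by rewrite /dotv trmx_mul trmxK mulmxA. Qed.

Lemma dotv_outer (a b : 'cV[R]_d) u v :
  dotv u ((a *m b^T) *m v) = dotv u a * dotv b v.
Proof.
rewrite /dotv -mulmxA mulmxA [b^T *m v]mx11_scalar mul_mx_scalar mxE mulrC.
by rewrite !mxE.
Qed.

Lemma mxnormE A v : mxnorm A v = Num.sqrt (dotv v (A *m v)).
Proof. by rewrite /mxnorm /dotv mulmxA. Qed.

(** The Loewner bound [A >= c I] with symmetry bundled in; [form_ge 0] is positive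
    semidefiniteness. *)
Definition form_ge (c : R) A := A^T = A /\ forall v, c * dotv v v <= dotv v (A *m v).

Lemma form_ge_ge0 c A v : 0 <= c -> form_ge c A -> 0 <= dotv v (A *m v).
Proof. by move=> c0 [_ /(_ v)]; apply: le_trans; rewrite mulr_ge0 ?dotv_ge0. Qed.

Lemma dotv_symC A u v : A^T = A -> dotv u (A *m v) = dotv v (A *m u).
Proof. by move=> sA; rewrite dotv_adj sA dotvC. Qed.

Lemma form_expand A u v : A^T = A ->
  dotv (u + v) (A *m (u + v)) = dotv u (A *m u) + 2 * dotv u (A *m v) + dotv v (A *m v).
Proof.
move=> sA; rewrite mulmxDr !dotvDl !dotvDr (dotv_symC v u sA); ring.
Qed.

(** The form is nonnegative on all combinations of [u] and [v], so its discriminant there is not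
    positive. *)
Lemma form_ge_CS A u v : form_ge 0 A ->
  dotv u (A *m v) ^+ 2 <= dotv u (A *m u) * dotv v (A *m v).
Proof.
move=> pA; have [sA _] := pA.
set k := dotv u (A *m v); set a := dotv u (A *m u); set b := dotv v (A *m v).
have b0 : 0 <= b by exact: form_ge_ge0 (lexx 0) pA.
have q (s t : R) : 0 <= s ^+ 2 * a + 2 * s * t * k + t ^+ 2 * b.
  have := form_ge_ge0 (s *: u + t *: v) (lexx 0) pA.
  rewrite mulmxDr -!scalemxAr !dotvDr !dotvDl !dotvZr !dotvZl.
  rewrite (dotv_symC v u sA) -/a -/b -/k; congr (_ <= _); ring.
case: (eqVneq b 0) => [b0' | bn0].
  rewrite b0' mulr0; case: (eqVneq k 0) => [->|kn0]; first by rewrite expr0n.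
  (* With [b = 0] the form is affine in the coefficient of [v]; for nonzero [k] this coefficient
     gives it the value [- 1]. *)
  have := q 1 (- (a + 1) / (2 * k)); rewrite b0'.
  have -> : 1 ^+ 2 * a + 2 * 1 * (- (a + 1) / (2 * k)) * k
              + (- (a + 1) / (2 * k)) ^+ 2 * 0 = - 1 by field.
  by rewrite ler0N1.
have bp : 0 < b by rewrite lt_neqAle eq_sym bn0.
rewrite -subr_ge0 -(pmulr_rge0 _ bp).
have := q b (- k); congr (_ <= _); ring.
Qed.

Lemma form_geW c c' A : c' <= c -> form_ge c A -> form_ge c' A.
Proof.
by move=> cc' [sA hA]; split=> // v; apply: le_trans (hA v); rewrite ler_wpM2r ?dotv_ge0.
Qed.

Lemma form_geD c c' A B : form_ge c A -> form_ge c' B -> form_ge (c + c') (A + B).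
Proof.
move=> [sA hA] [sB hB]; split; first by rewrite linearD /= sA sB.
by move=> v; rewrite mulmxDl dotvDr mulrDl lerD.
Qed.

Lemma form_geZ c k A : 0 <= k -> form_ge c A -> form_ge (k * c) (k *: A).
Proof.
move=> k0 [sA hA]; split; first by rewrite linearZ /= sA.
by move=> v; rewrite -scalemxAl dotvZr -mulrA ler_wpM2l.
Qed.

Lemma form_ge_scalar c : form_ge c (c%:M : 'M[R]_d).
Proof. by split=> [|v]; rewrite ?tr_scalar_mx // mul_scalar_mx dotvZr. Qed.

Lemma form_ge_outer v : form_ge 0 (v *m v^T).
Proof.
split=> [|u]; first by rewrite trmx_mul trmxK.
by rewrite mul0r dotv_outer (dotvC v) -expr2 sqr_ge0.
Qed.

Lemma form_ge_sum (I : Type) (s : seq I) (P : pred I) (F : I -> 'M[R]_d) :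
  (forall i, P i -> form_ge 0 (F i)) -> form_ge 0 (\sum_(i <- s | P i) F i).
Proof.
move=> hF; elim/big_ind: _ => [|A B hA hB|] //; last first.
  by rewrite -[0]addr0; exact: form_geD.
split=> [|v]; first by rewrite linear0.
by rewrite mul0r mul0mx dotv0r.
Qed.

(** A kernel vector has zero form, so coercivity forces it to vanish. *)
Lemma form_ge_unit c A : 0 < c -> form_ge c A -> A \in unitmx.
Proof.
move=> c0 [sA hA]; rewrite -row_free_unit -kermx_eq0; apply/eqP.
apply/row_matrixP => i; rewrite row0; set r := row i _.
have rA : r *m A = 0 by apply/eqP; rewrite /r -row_mul mulmx_ker row0.
have Ar : A *m r^T = 0 by rewrite -sA -trmx_mul rA trmx0.
have : dotv r^T r^T = 0.
  apply/eqP; rewrite eq_le dotv_ge0 andbT -(pmulr_rle0 _ c0).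
  by apply: le_trans (hA _) _; rewrite Ar dotv0r.
rewrite dotvE => /eqP; rewrite psumr_eq0; last by move=> j _; rewrite -expr2 sqr_ge0.
move=> /allP h; apply/rowP => j; have := h j (mem_index_enum j).
by rewrite -expr2 sqrf_eq0 => /eqP; rewrite !mxE.
Qed.

Lemma mulmxKV_col A (v : 'cV[R]_d) : A \in unitmx -> A *m (invmx A *m v) = v.
Proof. by move=> uA; rewrite mulmxA mulmxV // mul1mx. Qed.

Lemma invform_ge0 c A v : 0 < c -> form_ge c A -> 0 <= dotv v (invmx A *m v).
Proof.
move=> c0 hA; rewrite -{1}(mulmxKV_col v (form_ge_unit c0 hA)) dotvC.
exact: form_ge_ge0 (ltW c0) hA.
Qed.

Lemma form_ge_invmx c A : 0 < c -> form_ge c A -> form_ge 0 (invmx A).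
Proof.
move=> c0 hA; split=> [|v]; first by rewrite trmx_inv hA.1.
by rewrite mul0r; exact: invform_ge0 hA.
Qed.

(** With [y] the image of [v] under the inverse, [c * dotv y y <= dotv v y], and Cauchy-Schwarz
    bounds [dotv v y ^+ 2] by [dotv v v * dotv y y]. *)
Lemma invform_le c A v : 0 < c -> form_ge c A ->
  dotv v (invmx A *m v) <= dotv v v / c.
Proof.
move=> c0 hA; have uA := form_ge_unit c0 hA.
have := invform_ge0 v c0 hA; set y := invmx A *m v => z0.
have hy : c * dotv y y <= dotv v y.
  by have := hA.2 y; rewrite mulmxKV_col // dotvC.
have := form_ge_CS v y (form_geW (ltW ltr01) (form_ge_scalar 1)).
rewrite !mul_scalar_mx !scale1r => CS.
rewrite ler_pdivlMr //; have := dotv_ge0 v; have := dotv_ge0 y.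
move: z0 hy CS; set z := dotv v y; set a := dotv v v; set b := dotv y y.
rewrite le_eqVlt => /predU1P[<-|z0]; first by rewrite mul0r.
move=> hy CS b0 a0; rewrite -(ler_pM2r z0) ; nra.
Qed.

(** Inversion reverses the order. Cauchy-Schwarz for the form [B], at the images of [v] under both
    inverses, gives [a ^+ 2 <= k * b], and the hypothesis gives [k <= 2 * a]. *)
Lemma invform_le2 c A B v : 0 < c -> form_ge c A -> form_ge c B ->
  (forall u, dotv u (B *m u) <= 2 * dotv u (A *m u)) ->
  dotv v (invmx A *m v) <= 2 * dotv v (invmx B *m v).
Proof.
move=> c0 hA hB AB; have uA := form_ge_unit c0 hA; have uB := form_ge_unit c0 hB.
have := invform_ge0 v c0 hA; have := invform_ge0 v c0 hB.
have := form_ge_CS (invmx A *m v) (invmx B *m v) (form_geW (ltW c0) hB).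
have := AB (invmx A *m v).
rewrite !mulmxKV_col // !(dotvC _ v).
set a := dotv v (invmx A *m v); set b := dotv v (invmx B *m v); set k := dotv _ (B *m _).
move=> h1 h2 b0; rewrite le_eqVlt => /predU1P[<-|a0]; first lra.
by rewrite -(ler_pM2r a0); nra.
Qed.

(** The matrix determinant lemma, from two triangular factorizations of one bordered matrix. *)
Lemma det_rank1 A v : A \in unitmx ->
  \det (A + v *m v^T) = \det A * (1 + dotv v (invmx A *m v)).
Proof.
move=> uA.
have E1 : block_mx A (- v) v^T 1%:M
  = block_mx 1%:M (- v) 0 1%:M *m block_mx (A + v *m v^T) 0 v^T (1%:M : 'M[R]_1).
  by rewrite mulmx_block !mul1mx !mulmx1 ?mul0mx ?mulmx0 ?add0r mulNmx addrK.
have E2 : block_mx A (- v) v^T 1%:M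
  = block_mx A 0 v^T 1%:M
    *m block_mx 1%:M (- (invmx A *m v)) 0 (1%:M + v^T *m (invmx A *m v) : 'M[R]_1).
  rewrite mulmx_block !mul1mx !mulmx1 ?mul0mx ?mulmx0 ?addr0 !mulmxN mulmxKV_col //.
  by rewrite addrCA addNr addr0.
move: E1; rewrite E2 => /(congr1 determinant).
rewrite !det_mulmx !det_lblock !det_ublock !det1 !mul1r !mulr1 => <-.
by rewrite det_mx11 mxE mxE eqxx.
Qed.

End Dot.

(** * Schur complements, Hadamard's inequality and log-determinants *)

Section Schur.
Variable R : realType.

Lemma dotv_col_mx m n (a c : 'cV[R]_m) (b e : 'cV[R]_n) :
  dotv (col_mx a b) (col_mx c e) = dotv a c + dotv b e.
Proof. by rewrite /dotv tr_col_mx mul_row_col mxE. Qed.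

Lemma dotv_scalar (x y : R) : dotv (x%:M : 'cV[R]_1) y%:M = x * y.
Proof. by rewrite /dotv tr_scalar_mx mul_scalar_mx !mxE eqxx. Qed.

(** Block elimination of the first coordinate. The vector returned is the off-diagonal column
    divided by the square root of the pivot, so that the removed part is a plain outer product, as
    in [det_rank1]. *)
Lemma schur_decomposition n (c : R) (H : 'M[R]_(1 + n)) : 0 < c -> form_ge c H ->
  let a := H 0 0 in
  exists (D : 'M[R]_n) (b : 'cV[R]_n),
    [/\ 0 < a, form_ge c D, \det H = a * \det D & drsubmx H = D + b *m b^T].
Proof.
move=> c0 hH a; have [sH qH] := hH.
set b := dlsubmx H; set D0 := drsubmx H.
have Hb : H = block_mx a%:M b^T b D0.
  rewrite -{1}[H]submxK; congr (block_mx _ _ _ _).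
    by rewrite [LHS]mx11_scalar !mxE; congr (H _ _)%:M; apply/val_inj.
  by rewrite /b trmx_dlsub sH.
have btv (v : 'cV[R]_n) : b^T *m v = (dotv b v)%:M by rewrite [LHS]mx11_scalar.
have qV (k : R) (v : 'cV[R]_n) :
    c * (k ^+ 2 + dotv v v) <= k ^+ 2 * a + 2 * k * dotv b v + dotv v (D0 *m v).
  have := qH (col_mx k%:M v).
  rewrite Hb mul_block_col !dotv_col_mx btv mul_scalar_mx scale_scalar_mx.
  rewrite !dotvDr !dotv_scalar mul_mx_scalar dotvZr (dotvC v b).
  by move=> h; apply: le_trans h _; rewrite le_eqVlt; apply/orP; left; apply/eqP; ring.
have a0 : 0 < a.
  apply: lt_le_trans c0 _; have := qV 1 0.
  by rewrite mulmx0 !dotv0r expr1n !mulr0 !addr0 mulr1 mul1r.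
have sa : Num.sqrt a^-1 ^+ 2 = a^-1 by rewrite sqr_sqrtr // invr_ge0 ltW.
exists (D0 - a^-1 *: (b *m b^T)), (Num.sqrt a^-1 *: b).
have bb : (Num.sqrt a^-1 *: b) *m (Num.sqrt a^-1 *: b)^T = a^-1 *: (b *m b^T).
  by rewrite linearZ /= -scalemxAl -scalemxAr scalerA -expr2 sa.
split=> //; last by rewrite bb subrK.
- split.
    rewrite linearB linearZ /= trmx_mul trmxK; congr (_ - _).
    by rewrite /D0 trmx_drsub sH.
  (* This first coordinate minimizes the form when the others are [v]; the minimum is the Schur
     complement at [v]. *)
  move=> v; have := qV (- (a^-1 * dotv b v)) v.
  rewrite mulmxBl dotvBr -scalemxAl dotvZr dotv_outer (dotvC v b).
  set k := dotv b v; set q := dotv v (D0 *m v); set vv := dotv v v.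
  have -> : (- (a^-1 * k)) ^+ 2 * a + 2 * (- (a^-1 * k)) * k + q = q - a^-1 * (k * k).
    by field; rewrite gt_eqF.
  by apply: le_trans; rewrite ler_pM2l // lerDr sqr_ge0.
have -> : H = block_mx 1%:M 0 (a^-1 *: b) 1%:M
              *m block_mx a%:M b^T 0 (D0 - a^-1 *: (b *m b^T)).
  rewrite mulmx_block !mul1mx ?mul0mx ?mulmx0 ?addr0 -!scalemxAl.
  by rewrite mul_mx_scalar scalerA mulVf ?gt_eqF // scale1r [in X in block_mx _ _ _ X]addrC subrK.
by rewrite det_mulmx det_lblock det_ublock !det1 !mul1r det_scalar1.
Qed.

Lemma form_ge_det_gt0 n (c : R) (H : 'M[R]_n) : 0 < c -> form_ge c H -> 0 < \det H.
Proof.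
move=> c0; elim: n H => [|n IH] H hH; first by rewrite det_mx00.
have [D [b [a0 hD -> _]]] := @schur_decomposition n c H c0 hH.
by rewrite mulr_gt0 // IH.
Qed.

(* Weak form of Hadamard's inequality, by induction on Schur complements. *)
Lemma form_ge_det_le n (c k : R) (H : 'M[R]_n) : 0 < c -> form_ge c H ->
  (forall i, H i i <= k) -> \det H <= k ^+ n.
Proof.
move=> c0; elim: n H => [|n IH] H hH hk; first by rewrite det_mx00.
have [D [b [a0 hD -> HD]]] := @schur_decomposition n c H c0 hH.
have D0 := form_ge_det_gt0 c0 hD; rewrite exprS.
apply: le_trans (_ : H 0 0 * \det (@drsubmx _ 1 n 1 n H) <= _).
  rewrite ler_pM2l // HD det_rank1 ?(form_ge_unit c0) // ler_pMr //.
  by rewrite lerDl; exact: invform_ge0 c0 hD.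
have hd : form_ge c (@drsubmx _ 1 n 1 n H).
  by rewrite HD -[c]addr0; apply: form_geD => //; exact: form_ge_outer.
apply: ler_pM => //; first exact: ltW.
  by apply/ltW/(form_ge_det_gt0 c0).
by apply: IH => // i; rewrite !mxE.
Qed.

(* Each rank one update multiplies the determinant by [1 + x] with [0 <= x <= 1],
   and [ln (1 + x) >= x / 2]; the matrices met along the way are at most [2 H]. *)
Lemma trace_le_ln_det n (c : R) (H : 'M[R]_n) (I : finType) (P : pred I)
    (v : I -> 'cV[R]_n) : 1 <= c -> form_ge c H ->
  (forall u, \sum_(i | P i) dotv (v i) u ^+ 2 <= dotv u u) ->
  \sum_(i | P i) dotv (v i) (invmx H *m v i)
  <= 4 * (ln (\det (H + \sum_(i | P i) v i *m (v i)^T)) - ln (\det H)).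
Proof.
move=> c1 hH hv; have c0 : 0 < c by exact: lt_le_trans c1.
have v1 i : P i -> dotv (v i) (v i) <= 1.
  move=> Pi; have : dotv (v i) (v i) ^+ 2 <= dotv (v i) (v i).
    apply: le_trans (hv (v i)); rewrite (bigD1 i) //= lerDl.
    by rewrite sumr_ge0 // => j _; rewrite sqr_ge0.
  have := dotv_ge0 (v i); move: (dotv _ _) => y y0 yy.
  by rewrite leNgt; apply/negP => y1; nra.
do 2 rewrite -[\sum_(i | P i) _]big_filter.
have : forall u, \sum_(i <- [seq i <- index_enum I | P i]) dotv (v i) u ^+ 2 <= dotv u u.
  by move=> u; rewrite big_filter.
have : all P [seq i <- index_enum I | P i] by exact: filter_all.
elim/last_ind: [seq i <- index_enum I | P i] => [_ _|s i IH].
  by rewrite !big_nil addr0 subrr mulr0.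
rewrite all_rcons => /andP[Pi Ps] hs.
rewrite -!cats1 !big_cat /= !big_seq1 addrA.
set K := H + \sum_(j <- s) _.
have hK : form_ge c K.
  rewrite -[c]addr0; apply: form_geD => //; apply: form_ge_sum => j _.
  exact: form_ge_outer.
have hsu u : \sum_(j <- s) dotv (v j) u ^+ 2 <= dotv u u.
  apply: le_trans (hs u); rewrite -cats1 big_cat /= big_seq1 lerDl sqr_ge0 //.
have {}IH := IH Ps hsu.
have K2 u : dotv u (K *m u) <= 2 * dotv u (H *m u).
  rewrite /K mulmxDl dotvDr mulmx_suml mulr2n mulrDl mul1r lerD2l.
  rewrite (big_morph _ (dotvDr u) (dotv0r u)).
  apply: le_trans (le_trans (hsu u) _).
    by apply: ler_sum => j _; rewrite dotv_outer dotvC -expr2.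
  apply: le_trans (hH.2 u); rewrite ler_peMl ?dotv_ge0 //.
have dK := form_ge_det_gt0 c0 hK.
have uK := form_ge_unit c0 hK.
have x0 := invform_ge0 (v i) c0 hK.
have x1 : dotv (v i) (invmx K *m v i) <= 1.
  apply: le_trans (invform_le (v i) c0 hK) _; rewrite ler_pdivrMr // mul1r.
  exact: le_trans (v1 i Pi) c1.
have := invform_le2 (v i) c0 hH hK K2.
rewrite det_rank1 // lnM ?posrE //; last by rewrite ltr_wpDr.
move: x0 x1 IH; set x := dotv _ (invmx K *m _) => x0 x1 IH hx.
suff : x <= 2 * ln (1 + x) by lra.
have y0 : 0 < 1 + x by lra.
(* Since [expR (- (x / 2)) >= 1 - x / 2], it suffices that [(1 + x) * (1 - x / 2) >= 1], which is
   where [x <= 1] enters. *)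
have e1 : expR (x / 2) <= 1 + x.
  have := expR_ge1Dx (- (x / 2)); rewrite expRN => h.
  have e0 := expR_gt0 (x / 2).
  have : (1 - x / 2) * expR (x / 2) <= 1.
    by rewrite -[leRHS](mulVf (lt0r_neq0 e0)) ler_pM2r.
  nra.
have := e1; rewrite -ler_ln ?posrE ?expR_gt0 // expRK; lra.
Qed.
End Schur.

(** * The multinomial logit law *)

Section FiniteProb.
Variables (R : realType) (I : finType) (P : pred I) (q : I -> R).
Hypothesis q1 : \sum_(i | P i) q i = 1.
Hypothesis q0 : forall i, P i -> 0 <= q i.

(** The two sides differ by [(c - m) ^+ 2], with [m] the mean; upper bounds on a variance may thus
    use any center. *)
Lemma variance_le (a : I -> R) (c : R) :
  \sum_(i | P i) q i * (a i - \sum_(j | P j) q j * a j) ^+ 2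
  <= \sum_(i | P i) q i * (a i - c) ^+ 2.
Proof.
set m := \sum_(j | P j) q j * a j.
have E (t : R) : \sum_(i | P i) q i * (a i - t) ^+ 2
               = \sum_(i | P i) q i * a i ^+ 2 - 2 * t * m + t ^+ 2.
  rewrite (eq_bigr (fun i => q i * a i ^+ 2 - 2 * t * (q i * a i) + t ^+ 2 * q i)).
    by rewrite !big_split /= sumrN -!mulr_sumr q1 mulr1.
  by move=> i _; ring.
rewrite !E -subr_ge0.
have -> : \sum_(i | P i) q i * a i ^+ 2 - 2 * c * m + c ^+ 2 -
  (\sum_(i | P i) q i * a i ^+ 2 - 2 * m * m + m ^+ 2) = (c - m) ^+ 2 by ring.
exact: sqr_ge0.
Qed.

(** Jensen's inequality, from the tangent to the exponential at the mean. *)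
Lemma expR_mean_le (a : I -> R) :
  expR (\sum_(i | P i) q i * a i) <= \sum_(i | P i) q i * expR (a i).
Proof.
set m := \sum_(i | P i) _.
have -> : expR m = \sum_(i | P i) q i * (expR m * (1 + (a i - m))).
  rewrite (eq_bigr (fun i => expR m * (q i * (1 - m) + q i * a i))); last first.
    by move=> i _; ring.
  by rewrite -mulr_sumr big_split /= -mulr_suml q1 -/m mul1r subrK mulr1.
apply: ler_sum => i Pi; rewrite ler_wpM2l ?q0 //.
have -> : expR (a i) = expR m * expR (a i - m) by rewrite -expRD addrC subrK.
rewrite ler_pM2l ?expR_gt0 //.
exact: expR_ge1Dx.
Qed.

End FiniteProb.

(** * Scalar inequalities for the exponential *)

Section Scalar.
Variable R : realType.
Implicit Types y c : R.

Lemma expR_le1D2x y : 0 <= y -> y <= 2^-1 -> expR y <= 1 + 2 * y.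
Proof.
move=> y0 y1; have := expR_ge1Dx (- y); rewrite expRN => h.
have e0 := expR_gt0 y.
have : (1 - y) * expR y <= 1.
  by rewrite -[leRHS](mulVf (lt0r_neq0 e0)) ler_pM2r.
nra.
Qed.

Lemma expR_le1D4x y : 0 <= y -> y <= 72^-1 -> expR (2 * y) <= 1 + 4 * y.
Proof.
move=> y0 y1; have h : expR (2 * y) <= 1 + 2 * (2 * y) by apply: expR_le1D2x; lra.
lra.
Qed.

(** For [y >= 0] this follows from [(1 + y) * expR (- y) <= 1]; for [y < 0] the right side is at
    least [y ^+ 2]. With [y] a log-likelihood ratio, the mean of the right side is a Jeffreys
    divergence. *)
Lemma jeffreys_scalar y c : `|y| <= c -> y ^+ 2 / (1 + c) <= (1 - expR (- y)) * y.
Proof.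
move=> yc; have c0 : 0 <= c by apply: le_trans yc.
have c1 : 0 < 1 + c by lra.
rewrite ler_pdivrMr //; have := yc; rewrite ler_norml => /andP[yl yu].
have [y0|y0] := leP 0 y.
  have := expR_ge1Dx y; have e0 := expR_gt0 (- y).
  have : expR y * expR (- y) = 1 by rewrite -expRD subrr expR0.
  move: e0; set e := expR (- y); set f := expR y => e0 ef fy.
  have : (1 + y) * e <= 1 by rewrite -[leRHS]ef ler_pM2r.
  have e1 : e <= 1 by nra.
  move=> h; have : (1 - e) * (1 + c) >= y by nra.
  by move=> h2; nra.
have := expR_ge1Dx (- y); set e := expR (- y) => h.
have : y ^+ 2 <= (1 - e) * y by nra.
have : 0 <= y ^+ 2 by rewrite sqr_ge0.
nra.
Qed.

End Scalar.

Lemma dotv_feature_le (R : realType) (d N : nat) (x : 'I_N -> 'cV[R]_d) o u :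
  (forall i, norm2 (x i) <= 1) -> dotv (feature x o) u ^+ 2 <= dotv u u.
Proof.
move=> x1; have f1 : dotv (feature x o) (feature x o) <= 1.
  case: o => [i|] /=; last by rewrite dotv0l.
  by rewrite -norm2_sqr expr_le1 ?norm2_ge0.
have := form_ge_CS (feature x o) u (form_geW ler01 (form_ge_scalar d 1)).
rewrite !mul_scalar_mx !scale1r => h; apply: le_trans h _.
by rewrite ler_piMl ?dotv_ge0.
Qed.

Section MNL.
Variables (R : realType) (d N : nat) (x : 'I_N -> 'cV[R]_d) (S : {set 'I_N}).
Implicit Types (u v w : 'cV[R]_d) (o : option 'I_N).

Definition mnl_weight w : R := \sum_(o | offered S o) expR (dotv (feature x o) w).

Definition mnl_mean w : 'cV[R]_d :=
  \sum_(o | offered S o) mnl_prob x S w o *: feature x o.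

(** The Hessian of [ln (mnl_weight w)], hence of the loss for every offered choice (see
    [mnl_hessian]); the centered form makes semidefiniteness evident. *)
Definition mnl_cov w : 'M[R]_d :=
  \sum_(o | offered S o) mnl_prob x S w o *:
    ((feature x o - mnl_mean w) *m (feature x o - mnl_mean w)^T).

(** The outside option has feature 0 and contributes the leading 1. *)
Lemma mnl_weightE w : 1 + \sum_(j in S) expR (dotv (x j) w) = mnl_weight w.
Proof.
rewrite /mnl_weight (bigD1 None) //= dotv0l expR0; congr (_ + _).
rewrite (reindex_omap (fun i : 'I_N => Some i) id) /=; last by case.
by apply: eq_bigl => i; rewrite eqxx !andbT.
Qed.

Lemma mnl_weight_gt0 w : 0 < mnl_weight w.
Proof.
rewrite -mnl_weightE ltr_wpDr //.
by rewrite sumr_ge0 // => i _; exact: expR_ge0.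
Qed.

Lemma mnl_probE w o : mnl_prob x S w o = expR (dotv (feature x o) w) / mnl_weight w.
Proof. by rewrite /mnl_prob mnl_weightE. Qed.

Lemma mnl_prob_gt0 w o : 0 < mnl_prob x S w o.
Proof. by rewrite mnl_probE divr_gt0 ?expR_gt0 ?mnl_weight_gt0. Qed.

Lemma mnl_prob_ge0 w o : 0 <= mnl_prob x S w o.
Proof. exact/ltW/mnl_prob_gt0. Qed.

Lemma mnl_prob_sum w : \sum_(o | offered S o) mnl_prob x S w o = 1.
Proof.
under eq_bigr do rewrite mnl_probE.
by rewrite -mulr_suml divff // gt_eqF // mnl_weight_gt0.
Qed.

Lemma ln_mnl_prob w o :
  ln (mnl_prob x S w o) = dotv (feature x o) w - ln (mnl_weight w).
Proof. by rewrite mnl_probE ln_div ?posrE ?expR_gt0 ?mnl_weight_gt0 // expRK. Qed.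

Lemma mnl_lossE c w : offered S c -> mnl_loss x S c w = - ln (mnl_prob x S w c).
Proof.
move=> Sc; rewrite /mnl_loss (bigD1 c) //= eqxx mul1r big1 ?addr0 // => o.
by rewrite eq_sym => /andP[_ /negPf->]; rewrite mul0r.
Qed.

Lemma dotv_mean w u :
  dotv (mnl_mean w) u = \sum_(o | offered S o) mnl_prob x S w o * dotv (feature x o) u.
Proof. by rewrite /mnl_mean dotv_suml; apply: eq_bigr => o _; rewrite dotvZl. Qed.

Lemma mnl_cov_bilin w v u : dotv v (mnl_cov w *m u) =
  \sum_(o | offered S o) mnl_prob x S w o * dotv (feature x o) v * dotv (feature x o) u
  - dotv (mnl_mean w) v * dotv (mnl_mean w) u.
Proof.
rewrite /mnl_cov mulmx_suml dotv_sumr.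
rewrite (eq_bigr (fun o => mnl_prob x S w o * dotv (feature x o) v * dotv (feature x o) u
  - dotv (mnl_mean w) u * (mnl_prob x S w o * dotv (feature x o) v)
  - dotv (mnl_mean w) v * (mnl_prob x S w o * dotv (feature x o) u)
  + mnl_prob x S w o * (dotv (mnl_mean w) v * dotv (mnl_mean w) u))).
  rewrite !big_split /= !sumrN -!mulr_sumr -mulr_suml mnl_prob_sum -!dotv_mean; ring.
move=> o _; rewrite -scalemxAl dotvZr dotv_outer (dotvC v) !dotvBl; ring.
Qed.

Lemma mnl_cov_form w u : dotv u (mnl_cov w *m u) =
  \sum_(o | offered S o) mnl_prob x S w o * dotv (feature x o - mnl_mean w) u ^+ 2.
Proof.
rewrite /mnl_cov mulmx_suml dotv_sumr; apply: eq_bigr => o _.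
by rewrite -scalemxAl dotvZr dotv_outer (dotvC u) expr2.
Qed.

Lemma mnl_cov_le_second w u c : dotv u (mnl_cov w *m u) <=
  \sum_(o | offered S o) mnl_prob x S w o * (dotv (feature x o) u - c) ^+ 2.
Proof.
rewrite mnl_cov_form; under eq_bigr do rewrite dotvBl dotv_mean.
by apply: variance_le; exact: mnl_prob_sum.
Qed.

(** Bias-variance decomposition in the seminorm of [A]: the cross term has mean zero under the law
    at [w]. *)
Lemma mnl_mean_minimizes w (A : 'M[R]_d) (m : 'cV[R]_d) : form_ge 0 A ->
  \sum_(o | offered S o) mnl_prob x S w o *
    dotv (feature x o - mnl_mean w) (A *m (feature x o - mnl_mean w))
  <= \sum_(o | offered S o) mnl_prob x S w o *
    dotv (feature x o - m) (A *m (feature x o - m)).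
Proof.
move=> hA; pose g o := feature x o - mnl_mean w; pose e := mnl_mean w - m.
rewrite [leRHS](eq_bigr (fun o => mnl_prob x S w o * dotv (g o) (A *m g o)
  + 2 * (mnl_prob x S w o * dotv (g o) (A *m e))
  + mnl_prob x S w o * dotv e (A *m e))); last first.
  move=> o _; have -> : feature x o - m = g o + e by rewrite /g /e addrA subrK.
  by rewrite form_expand ?hA.1 //; ring.
rewrite !big_split /= -mulr_suml mnl_prob_sum mul1r -mulr_sumr.
have -> : \sum_(o | offered S o) mnl_prob x S w o * dotv (g o) (A *m e) = 0.
  under eq_bigr do rewrite dotvBl mulrBr.
  by rewrite sumrB -mulr_suml mnl_prob_sum mul1r dotv_mean subrr.
by rewrite mulr0 addr0 lerDl; exact: form_ge_ge0 (lexx 0) hA.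
Qed.

Lemma mnl_cov_le_id w u : (forall i, norm2 (x i) <= 1) ->
  dotv u (mnl_cov w *m u) <= dotv u u.
Proof.
move=> x1; apply: le_trans (mnl_cov_le_second w u 0) _.
rewrite -[leRHS]mul1r -(mnl_prob_sum w) mulr_suml ler_sum // => o _.
by rewrite ler_wpM2l ?mnl_prob_ge0 // subr0 dotv_feature_le.
Qed.

Lemma mnl_cov_psd w : form_ge 0 (mnl_cov w).
Proof.
apply: form_ge_sum => o _; rewrite -[0](mulr0 (mnl_prob x S w o)).
by apply: form_geZ; [exact: mnl_prob_ge0|exact: form_ge_outer].
Qed.

Lemma mnl_cov_le_sqr w u a :
  (forall o, offered S o -> `|dotv (feature x o) u| <= a) ->
  dotv u (mnl_cov w *m u) <= a ^+ 2.
Proof.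
move=> ha; apply: le_trans (mnl_cov_le_second w u 0) _.
rewrite -[leRHS]mul1r -(mnl_prob_sum w) mulr_suml ler_sum // => o So.
rewrite ler_wpM2l ?mnl_prob_ge0 // subr0 -real_normK ?num_real //.
by rewrite lerXn2r ?nnegrE // ?ha // (le_trans _ (ha o So)).
Qed.

(** The numerator and the normalization each change by a factor of at most [expR r], hence the
    exponent [2 * r]. *)
Lemma mnl_prob_ratio v w r o : offered S o ->
  (forall o, offered S o -> `|dotv (feature x o) (w - v)| <= r) ->
  mnl_prob x S w o <= expR (2 * r) * mnl_prob x S v o.
Proof.
move=> So hr; rewrite !mnl_probE mulrA.
have E o' : offered S o' ->
  expR (dotv (feature x o') w) <= expR r * expR (dotv (feature x o') v) /\
  expR (dotv (feature x o') v) <= expR r * expR (dotv (feature x o') w).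
  move=> So'; have := hr o' So'; rewrite dotvBr ler_norml => /andP[h1 h2].
  by rewrite -!expRD !ler_expR; split; lra.
have Zr : mnl_weight v <= expR r * mnl_weight w.
  by rewrite /mnl_weight mulr_sumr; apply: ler_sum => o' /E[].
rewrite ler_pdivrMr ?mnl_weight_gt0 // mulrAC ler_pdivlMr ?mnl_weight_gt0 //.
apply: le_trans (ler_pM (expR_ge0 _) (ltW (mnl_weight_gt0 v)) (E o So).1 Zr) _.
by rewrite mulr2n mulrDl mul1r expRD le_eqVlt; apply/orP; left; apply/eqP; ring.
Qed.

(** Centering at the mean at [v] can only increase the second moment at [w]; the probabilities are
    then compared one by one. *)
Lemma mnl_cov_ratio v w u r :
  (forall o, offered S o -> `|dotv (feature x o) (w - v)| <= r) ->
  dotv u (mnl_cov w *m u) <= expR (2 * r) * dotv u (mnl_cov v *m u).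
Proof.
move=> hr; apply: le_trans (mnl_cov_le_second w u (dotv (mnl_mean v) u)) _.
rewrite mnl_cov_form mulr_sumr ler_sum // => o So.
by rewrite -dotvBl mulrA ler_wpM2r ?sqr_ge0 // mnl_prob_ratio.
Qed.

(** Only [ln (mnl_weight _)] is nonlinear in the parameter, and its convexity is Jensen's inequality
    for the law at [v]. *)
Lemma ln_mnl_prob_concave u v c :
  ln (mnl_prob x S u c) - ln (mnl_prob x S v c)
  <= dotv (feature x c - mnl_mean v) (u - v).
Proof.
rewrite !ln_mnl_prob dotvBl [dotv (feature x c) (u - v)]dotvBr.
suff : dotv (mnl_mean v) (u - v) <= ln (mnl_weight u) - ln (mnl_weight v) by lra.
rewrite -ler_expR expRB !lnK ?posrE ?mnl_weight_gt0 // dotv_mean.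
apply: le_trans (expR_mean_le (mnl_prob_sum v) _ _) _.
  by move=> o _; exact: mnl_prob_ge0.
rewrite [mnl_weight u]/mnl_weight mulr_suml; apply: ler_sum => o _.
rewrite mnl_probE mulrAC -expRD dotvBr addrC subrK //.
Qed.

(* [1 - s] times the right hand side is the Jeffreys divergence of the laws at [w] and [v]. *)
Lemma mnl_mean_gap u w v s a : v = u + s *: (w - u) -> 0 <= s -> s < 1 ->
  (forall o, offered S o -> `|dotv (feature x o) (w - u)| <= a) ->
  (1 - s) / (1 + 2 * a * (1 - s)) * dotv (w - u) (mnl_cov w *m (w - u))
  <= dotv (mnl_mean w - mnl_mean v) (w - u).
Proof.
move=> vE s0 s1 ha; set D := w - u.
have wv : w - v = (1 - s) *: D by rewrite vE scalerBl scale1r opprD addrA.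
have t0 : 0 < 1 - s by lra.
pose p := mnl_prob x S w; pose q := mnl_prob x S v.
pose k := ln (mnl_weight w) - ln (mnl_weight v).
(* [Y] is the log-likelihood ratio of [p] to [q]; two uses of [mnl_prob_ratio] bound it by [c]. *)
pose Y o := (1 - s) * dotv (feature x o) D - k.
have YE o : Y o = ln (p o) - ln (q o).
  rewrite /Y /p /q !ln_mnl_prob -dotvZr -wv dotvBr /k; ring.
have qE o : q o = p o * expR (- Y o).
  rewrite YE opprB expRB !lnK ?posrE ?mnl_prob_gt0 // mulrC divfK //.
  by rewrite gt_eqF // mnl_prob_gt0.
have hr o : offered S o -> `|dotv (feature x o) (w - v)| <= (1 - s) * a.
  by move=> So; rewrite wv dotvZr normrM gtr0_norm // ler_pM2l // ha.
have hr' o : offered S o -> `|dotv (feature x o) (v - w)| <= (1 - s) * a.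
  by move=> So; rewrite -opprB dotvNr normrN hr.
pose c := 2 * a * (1 - s).
have Yc o : offered S o -> `|Y o| <= c.
  move=> So; have cE : 2 * ((1 - s) * a) = c by rewrite /c; ring.
  have := mnl_prob_ratio So hr; have := mnl_prob_ratio So hr'.
  rewrite -/(p o) -/(q o) cE => h1 h2.
  have L (y z : R) : 0 < y -> 0 < z -> y <= expR c * z -> ln y <= c + ln z.
    move=> y0 z0; rewrite -ler_ln ?posrE ?mulr_gt0 ?expR_gt0 //.
    by rewrite lnM ?posrE ?expR_gt0 // expRK.
  have := L _ _ (mnl_prob_gt0 _ _) (mnl_prob_gt0 _ _) h1.
  have := L _ _ (mnl_prob_gt0 _ _) (mnl_prob_gt0 _ _) h2.
  by rewrite YE ler_norml => *; apply/andP; split; lra.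
have c0 : 0 <= c by apply: le_trans (Yc None isT).
have c1 : 0 < 1 + c by lra.
(* Summing [(p o - q o) * Y o] removes the constant [k], as both laws have mass one. *)
have J : (1 - s) * dotv (mnl_mean w - mnl_mean v) D
       = \sum_(o | offered S o) p o * ((1 - expR (- Y o)) * Y o).
  have -> : \sum_(o | offered S o) p o * ((1 - expR (- Y o)) * Y o)
     = (1 - s) * (\sum_(o | offered S o) p o * dotv (feature x o) D
                - \sum_(o | offered S o) q o * dotv (feature x o) D)
       - k * (\sum_(o | offered S o) p o - \sum_(o | offered S o) q o).
    rewrite -!sumrB !mulr_sumr -sumrB; apply: eq_bigr => o _.
    by rewrite qE /Y; ring.
  by rewrite !mnl_prob_sum subrr mulr0 subr0 dotvBl !dotv_mean.
rewrite -(ler_pM2l t0) J.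
apply: le_trans (_ : \sum_(o | offered S o) p o * (Y o ^+ 2 / (1 + c)) <= _); last first.
  apply: ler_sum => o So; rewrite ler_wpM2l ?mnl_prob_ge0 //.
  exact/jeffreys_scalar/Yc.
(* Centering at [k / (1 - s)] makes each deviation equal to [Y o / (1 - s)]. *)
have V := mnl_cov_le_second w D (k / (1 - s)).
rewrite -/c.
set q2 := dotv D _ in V *.
have -> : (1 - s) * ((1 - s) / (1 + c) * q2) = (1 - s) ^+ 2 * q2 / (1 + c) by ring.
under eq_bigr do rewrite mulrA.
rewrite -mulr_suml ler_pM2r ?invr_gt0 //.
rewrite -ler_pdivlMl ?exprn_gt0 //; apply: le_trans V _.
rewrite mulr_sumr le_eqVlt; apply/orP; left; apply/eqP; apply: eq_bigr => o _.
by rewrite /Y /p; field; rewrite gt_eqF.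
Qed.

End MNL.

(** * Gradient and Hessian of the loss *)

Section Calculus.
Variable R : realType.

(** Reduces a directional derivative to one real variable, where the rules for [is_derive] apply. *)
Lemma derive_line d (f : 'cV[R]_d -> R) (w v : 'cV[R]_d) :
  'D_v f w = 'D_1 (fun h : R => f (w + h *: v)) 0.
Proof.
rewrite /derive.
rewrite (_ : (fun h : R => h^-1 *: ((f \o shift w) (h *: v) - f w)) = fun h : R =>
  h^-1 *: (((fun k : R => f (w + k *: v)) \o shift 0) (h *: 1) - f (w + 0 *: v))) //.
by apply/funext => h /=; rewrite addr0 scale0r addr0 [h *: 1]mulr1 (addrC w).
Qed.

Lemma is_derive_finsum (I : Type) (s : seq I) (P : pred I) (f : I -> R -> R)
    (df : I -> R) (t : R) :
  (forall i, is_derive t 1 (f i) (df i)) ->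
  is_derive t 1 (fun h => \sum_(i <- s | P i) f i h) (\sum_(i <- s | P i) df i).
Proof.
move=> hf; elim: s => [|i s IH].
  under eq_fun do rewrite big_nil; rewrite big_nil; exact: is_derive_cst.
under eq_fun do rewrite big_cons; rewrite big_cons.
by case: (P i) => //; exact: is_deriveD.
Qed.

Lemma is_derive_affine (a b t : R) : is_derive t 1 (fun h : R => a + h * b) b.
Proof.
rewrite (_ : (fun h : R => a + h * b) = cst a + b \*: id); last first.
  by apply/funext => h /=; rewrite mulrC.
by apply: is_derive_eq; rewrite add0r [_ *: _]mulr1.
Qed.

Lemma is_derive_exp_affine (a b k : R) :
  is_derive (0 : R) 1 (fun h : R => expR (a + h * b) * k) (expR a * b * k).
Proof.
rewrite (_ : (fun h : R => expR (a + h * b) * k)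
  = k \*: (expR \o (fun h => a + h * b))); last first.
  by apply/funext => h /=; rewrite mulrC.
have h1 := is_derive_affine a b 0.
have := @is_derive1_comp R expR _ 0 _ _ (is_derive_expR _) h1.
rewrite /= mul0r addr0 => h2; apply: is_derive_eq.
by rewrite [_ *: _]mulrC.
Qed.

Variables (d N : nat) (x : 'I_N -> 'cV[R]_d) (S : {set 'I_N}).

Lemma is_derive_mnl_sum (w v : 'cV[R]_d) (k : option 'I_N -> R) :
  is_derive (0 : R) 1
    (fun h : R => \sum_(o | offered S o) expR (dotv (feature x o) (w + h *: v)) * k o)
    (\sum_(o | offered S o) expR (dotv (feature x o) w) * dotv (feature x o) v * k o).
Proof.
apply: is_derive_finsum => o.
rewrite (_ : (fun h : R => _) = fun h : R =>
   expR (dotv (feature x o) w + h * dotv (feature x o) v) * k o).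
  exact: is_derive_exp_affine.
by apply/funext => h; rewrite dotvDr dotvZr.
Qed.

Lemma is_derive_mnl_weight (w v : 'cV[R]_d) :
  is_derive (0 : R) 1 (fun h : R => mnl_weight x S (w + h *: v))
    (mnl_weight x S w * dotv (mnl_mean x S w) v).
Proof.
have := is_derive_mnl_sum w v (fun=> 1).
under eq_fun do under eq_bigr do rewrite mulr1.
move=> h; apply: is_derive_eq h _; rewrite dotv_mean mulr_sumr.
apply: eq_bigr => o _; rewrite mnl_probE; field.
by rewrite gt_eqF // mnl_weight_gt0.
Qed.

Lemma mnl_loss_derive (c : option 'I_N) (w v : 'cV[R]_d) : offered S c ->
  'D_v (mnl_loss x S c) w = dotv (mnl_mean x S w - feature x c) v.
Proof.
move=> Sc; rewrite derive_line.
rewrite (_ : (fun h : R => _) =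
  (@ln R \o (fun h : R => mnl_weight x S (w + h *: v))) -
   (fun h => dotv (feature x c) w + h * dotv (feature x c) v)); last first.
  by apply/funext => h /=; rewrite mnl_lossE // ln_mnl_prob opprB dotvDr dotvZr.
have Z0 : 0 < mnl_weight x S (w + 0 *: v) by exact: mnl_weight_gt0.
have h1 := @is_derive1_comp R (@ln R) _ 0 _ _ (is_derive1_ln Z0) (is_derive_mnl_weight w v).
have h2 := is_derive_affine (dotv (feature x c) w) (dotv (feature x c) v) 0.
rewrite derive_val scale0r addr0 dotvBl mulKf //.
by rewrite gt_eqF // mnl_weight_gt0.
Qed.

Lemma mnl_gradient (c : option 'I_N) (w : 'cV[R]_d) : offered S c ->
  gradient (mnl_loss x S c) w = mnl_mean x S w - feature x c.
Proof.
move=> Sc; apply/colP => i; rewrite !mxE mnl_loss_derive //.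
rewrite dotvE (bigD1 i) //= big1 ?addr0; last first.
  by move=> j ji; rewrite [delta_mx _ _ _ _]mxE (negPf ji) mulr0.
by rewrite [delta_mx _ _ _ _]mxE !eqxx mulr1 !mxE.
Qed.

(** The constant [k] stands for the product with the chosen feature in the first derivative of the
    loss. Differentiating the ratio of exponential sums gives a covariance. *)
Lemma mnl_mean_derive (w v u : 'cV[R]_d) (k : R) :
  'D_v (fun z => dotv (mnl_mean x S z) u - k) w
  = dotv v (mnl_cov x S w *m u).
Proof.
rewrite derive_line.
rewrite (_ : (fun h : R => _) =
  (fun h : R => \sum_(o | offered S o) expR (dotv (feature x o) (w + h *: v))
                  * dotv (feature x o) u)
  * (@GRing.inv R \o (fun h : R => mnl_weight x S (w + h *: v))) - cst k); last first.
  apply/funext => h /=; congr (_ - _); rewrite dotv_mean [RHS]mulr_suml.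
  by apply: eq_bigr => o _; rewrite mnl_probE mulrAC.
have h1 := is_derive_mnl_sum w v (fun o => dotv (feature x o) u).
have Z0 : mnl_weight x S (w + 0 *: v) != 0 by rewrite gt_eqF // mnl_weight_gt0.
have h2 := is_derive_mnl_weight w v.
have h3 := is_deriveV Z0 h2.
rewrite derive_val /= scale0r addr0 subr0 mnl_cov_bilin.
rewrite [dotv (mnl_mean x S w) u]dotv_mean.
set A := \sum_(o | _) expR _ * dotv _ u; set B := \sum_(o | _) expR _ * _ * _.
have -> : \sum_(o | offered S o) mnl_prob x S w o * dotv (feature x o) v
            * dotv (feature x o) u = B / mnl_weight x S w.
  by rewrite mulr_suml; apply: eq_bigr => o _; rewrite mnl_probE; ring.
have -> : \sum_(o | offered S o) mnl_prob x S w o * dotv (feature x o) u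
          = A / mnl_weight x S w.
  by rewrite mulr_suml; apply: eq_bigr => o _; rewrite mnl_probE; ring.
move: Z0; rewrite scale0r addr0 => Z0; rewrite /GRing.scale /=.
by field.
Qed.

Lemma mnl_hessian (c : option 'I_N) (w : 'cV[R]_d) : offered S c ->
  hessian (mnl_loss x S c) w = mnl_cov x S w.
Proof.
move=> Sc; apply/matrixP => i j; rewrite !mxE.
under [X in 'D__ X _]eq_fun do rewrite mnl_loss_derive // dotvBl.
rewrite mnl_mean_derive dotvE (bigD1 i) //= big1 ?addr0; last first.
  by move=> k ki; rewrite [delta_mx _ _ _ _]mxE (negPf ki) mul0r.
rewrite [delta_mx _ _ _ _]mxE !eqxx mul1r mxE (bigD1 j) //= big1 ?addr0; last first.
  by move=> k ki; rewrite [delta_mx _ _ _ _]mxE (negPf ki) mulr0.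
by rewrite [delta_mx _ _ _ _]mxE !eqxx mulr1 .
Qed.
End Calculus.

(** * One mirror descent step *)

Section Argmin.
Variables (R : realType) (d : nat).
Implicit Types (g a u w : 'cV[R]_d) (A : 'M[R]_d) (W : set 'cV[R]_d).

Lemma convex_setP W u w t : convex_set (W : set (convex_lmodType 'cV[R]_d)) ->
  W u -> W w -> 0 <= t -> t <= 1 -> W (w + t *: (u - w)).
Proof.
move=> cW Wu Ww t0 t1; have := cW u w (Itv01 t0 t1).
rewrite !inE => /(_ Wu Ww); congr (W _).
rewrite [LHS](_ : _ = t *: u + (1 - t) *: w) //.
by rewrite scalerBl scale1r scalerBr addrCA.
Qed.

(** First-order optimality without derivatives: on the segment from [w] to [u] the objective changes
    by [t * (L + t * Q)], which forces [L >= 0]. *)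
Lemma quad_argmin W g A a k u w : convex_set (W : set (convex_lmodType 'cV[R]_d)) ->
  form_ge 0 A -> 0 <= k -> W u ->
  is_argmin W (fun v => dotv g v + k * dotv (v - a) (A *m (v - a))) w ->
  0 <= dotv g (u - w) + 2 * k * dotv (u - w) (A *m (w - a)).
Proof.
move=> cW hA k0 Wu [Ww wmin]; set D := u - w.
pose L := dotv g D + 2 * k * dotv D (A *m (w - a)).
pose Q := k * dotv D (A *m D).
have Q0 : 0 <= Q by rewrite mulr_ge0 // (form_ge_ge0 D (lexx 0) hA).
have h t : 0 < t -> t <= 1 -> 0 <= L + t * Q.
  move=> t0 t1; have := wmin _ (convex_setP cW Wu Ww (ltW t0) t1).
  rewrite -/D -[w + _ - a]addrAC -subr_ge0.
  rewrite /L /Q; clearbody D; move: (w - a) => e.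
  rewrite mulmxDr -scalemxAr !dotvDl !dotvDr !dotvZl !dotvZr.
  rewrite (dotv_symC e D hA.1) => hh; rewrite -(pmulr_rge0 _ t0).
  by move: hh; congr (_ <= _); ring.
rewrite -/L leNgt; apply/negP => L0.
(* If [L < 0], this step length lies in []0, 1]] even when [Q = 0], and it makes [L + t * Q]
   negative. *)
have := h (- L / (Q - L + 1)).
rewrite divr_gt0 ?ler_pdivrMr; [|lra..].
have -> : L + - L / (Q - L + 1) * Q = L * (1 - L) / (Q - L + 1) by field; lra.
rewrite pmulr_lge0 ?invr_gt0; last lra.
move=> /(_ isT); nra.
Qed.

Lemma mxnorm_sqr A w : form_ge 0 A -> mxnorm A w ^+ 2 = dotv w (A *m w).
Proof. by move=> hA; rewrite mxnormE sqr_sqrtr // (form_ge_ge0 w (lexx 0) hA). Qed.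

(** Squaring the norm turns the projection into a quadratic problem with no linear term; its
    optimality condition is the obtuse angle at [w], whence the Pythagorean inequality. *)
Lemma projection_le W A a u w : convex_set (W : set (convex_lmodType 'cV[R]_d)) ->
  form_ge 0 A -> W u -> is_argmin W (fun v => mxnorm A (v - a)) w ->
  dotv (w - u) (A *m (w - u)) <= dotv (a - u) (A *m (a - u)).
Proof.
move=> cW hA Wu [Ww wmin].
have := @quad_argmin W 0 A a 1 u w cW hA ler01 Wu.
have -> : dotv 0 (u - w) + 2 * 1 * dotv (u - w) (A *m (w - a))
  = 2 * dotv (u - w) (A *m (w - a)) by rewrite dotv0l; ring.
move=> h; have {}h : 0 <= 2 * dotv (u - w) (A *m (w - a)).
  apply: h; split=> // v Wv; rewrite !dotv0l !add0r !mul1r -!mxnorm_sqr //.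
  by rewrite lerXn2r ?nnegrE ?sqrtr_ge0 ?wmin.
have -> : a - u = (a - w) + (w - u) by rewrite addrA subrK.
move: h; rewrite -(opprB w u) -(opprB a w) mulmxN dotvNl dotvNr opprK.
move: (a - w) (w - u) => e D h.
rewrite mulmxDr !dotvDl !dotvDr (dotv_symC e D hA.1).
by have := form_ge_ge0 e (lexx 0) hA; lra.
Qed.
End Argmin.

Section Round.
Variable R : realType.

(* AM-GM: [c rho v <= 2/5 s v^2 + 5/8 (c rho)^2 / s] with [c = 2 eta + 4 alpha + 11/5]. *)
Lemma round_error (alpha eta lambda s z v k qq rho e : R) :
  0 < s -> s <= 1 -> 0 <= v -> v <= alpha -> `|k| <= v * rho -> 0 <= qq -> qq <= rho ^+ 2 ->
  0 <= rho -> rho <= 72^-1 -> 1 <= e -> e <= 1 + 4 * rho -> 0 < eta ->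
  lambda * rho ^+ 2 <= eta ^+ 2 * z ->
  72 <= lambda -> (2 * eta + 4 * alpha + 11 / 5) ^+ 2 <= lambda ->
  e * (v ^+ 2 + 2 * k + qq) - 2 * eta * k + 2 * eta * (eta * z)
  <= (1 + 2 / 5 * s) * v ^+ 2 + 4 * (eta ^+ 2 * z) / s.
Proof.
move=> s0 s1 v0 va hk qq0 hqq r0 r1 e1 e2 eta0 hl l72 hc.
set t := eta ^+ 2 * z / s.
have tE : eta ^+ 2 * z = s * t by rewrite /t; field; rewrite gt_eqF.
have -> : 2 * eta * (eta * z) = 2 * (s * t) by rewrite -tE; ring.
have -> : 4 * (eta ^+ 2 * z) / s = 4 * t by rewrite /t; ring.
rewrite tE in hl.
have rr : 0 <= rho ^+ 2 by rewrite sqr_ge0.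
have t0 : 0 <= t.
  rewrite -(pmulr_rge0 _ s0); apply: le_trans hl; rewrite mulr_ge0 //; lra.
pose c := 2 * eta + 4 * alpha + 11 / 5.
have vr : 0 <= v * rho by rewrite mulr_ge0.
have e11 : e <= 11 / 10 by lra.
have A1 : e * v ^+ 2 <= v ^+ 2 + 4 * alpha * (v * rho).
  have : e * v ^+ 2 <= (1 + 4 * rho) * v ^+ 2 by rewrite ler_wpM2r ?sqr_ge0.
  have : v * (v * rho) <= alpha * (v * rho) by rewrite ler_wpM2r.
  lra.
have A2 : e * (2 * k) - 2 * eta * k <= (2 * eta + 11 / 5) * (v * rho).
  have -> : e * (2 * k) - 2 * eta * k = 2 * (e - eta) * k by ring.
  apply: le_trans (ler_norm _) _; rewrite normrM.
  apply: ler_pM => //; rewrite ler_norml; apply/andP; split; lra.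
have A3 : e * qq <= 11 / 10 * rho ^+ 2 by apply: ler_pM => //; lra.
have A4 : c * (v * rho) <= 2 / 5 * s * v ^+ 2 + 5 / 8 * t.
  have h1 : c ^+ 2 * rho ^+ 2 <= s * t.
    by apply: le_trans hl; rewrite ler_wpM2r.
  have h2 : 0 <= (4 / 5 * s * v - c * rho) ^+ 2 by rewrite sqr_ge0.
  rewrite -(ler_pM2l s0); nra.
have A5 : 11 / 10 * rho ^+ 2 <= 1 / 10 * t.
  have : 72 * rho ^+ 2 <= s * t by apply: le_trans hl; rewrite ler_wpM2r.
  have : s * t <= t by rewrite ler_piMl.
  lra.
have A6 : s * t <= t by rewrite ler_piMl.
rewrite /c in A4; lra.
Qed.

(** The final arithmetic of [omd_round], over plain reals. With [D = w1 - w'] and [D' = w' - u]: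
    [Q1], [Q'], [X] are the squared [H]-norms of [w1 - u], [D'], [D]; [V] and [qq] the squared
    [G]-norms of [D'] and [D], and [k] their [G]-product; [QHD] is the [H]-product of [w1 - u] and
    [D]; [Gam] is the form of the new covariance at [w1 - u]; [mw], [mv], [fc] are the products of
    [D'] with the means at [w'] and [v] and with the chosen feature; [gD] is the product of the
    gradient with [D]; [ll] is the log-likelihood ratio of [v] to [u]. *)
Lemma round_combine (eta s Q1 Gam Q' QHD X k qq V z e gD mw mv fc ll : R) :
  0 < eta -> 0 < s -> 0 <= X -> 0 <= qq ->
  0 <= eta * - (mw - fc + gD) + - (QHD + eta * (k + qq)) ->
  Q1 = Q' + 2 * QHD - X ->
  Gam <= e * (V + 2 * k + qq) ->
  e * (V + 2 * k + qq) - 2 * eta * k + 2 * eta * (eta * z)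
    <= (1 + 2 / 5 * s) * V + 4 * (eta ^+ 2 * z) / s ->
  (1 + 2 / 5 * s) * V <= 2 * eta * (mw - mv) ->
  s * (fc - mv) <= ll -> - gD <= eta * z ->
  Q1 + Gam <= Q' + 2 * eta / s * (ll + 2 * eta * z).
Proof.
move=> eta0 s0 X0 qq0 opt E2 ratio err slack conc gz.
have {}conc : 2 * eta * (fc - mv) <= 2 * eta * (ll / s).
  by rewrite ler_pM2l ?mulr_gt0 // ler_pdivlMr // mulrC.
have {}gz : 2 * eta * - gD <= 2 * eta * (eta * z) by rewrite ler_pM2l ?mulr_gt0.
have -> : 2 * eta / s * (ll + 2 * eta * z) = 2 * eta * (ll / s) + 4 * (eta ^+ 2 * z) / s.
  by field; rewrite gt_eqF.
have qq1 : 0 <= eta * qq by rewrite mulr_ge0 // ltW.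
lra.
Qed.

(** The choice [s = a / (1 + a)] turns the coefficient of [mnl_mean_gap] into [(1 + 3 * a)^-1]. *)
Lemma step_coefE (a : R) : 0 < a ->
  (1 + 3 * a)^-1 = (1 - a / (1 + a)) / (1 + 2 * a * (1 - a / (1 + a))).
Proof. by move=> a0; field; rewrite !gt_eqF //; lra. Qed.

(** The numbers [21 / 5] and [17 / 4] bracket [3 * Num.sqrt 2]. The last conclusion is the slack
    that absorbs the second-order errors. *)
Lemma step_constants (alpha eta lambda : R) : 0 < alpha ->
  1 + 21 / 5 * alpha <= 2 * eta -> 2 * eta <= 1 + 17 / 4 * alpha ->
  72 * eta * alpha <= lambda -> 144 * eta <= lambda ->
  [/\ 72 <= lambda, (2 * eta + 4 * alpha + 11 / 5) ^+ 2 <= lambda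
    & 1 + 2 / 5 * (alpha / (1 + alpha)) <= 2 * eta / (1 + 3 * alpha)].
Proof.
move=> a0 h1 h2 h3 h4; split; first lra.
  have : 72 * (1 + 21 / 5 * alpha) * alpha <= 2 * lambda by nra.
  have : (2 * eta + 4 * alpha + 11 / 5) ^+ 2 <= (1 + 17 / 4 * alpha + 4 * alpha + 11 / 5) ^+ 2.
    by rewrite lerXn2r ?nnegrE //; lra.
  nra.
have a1 : 0 < 1 + alpha by lra.
have a3 : 0 < 1 + 3 * alpha by lra.
rewrite ler_pdivlMr // -(ler_pM2r a1).
(* With [2 / 5], the quadratic coefficient equals that of [(1 + 21 / 5 * alpha) * (1 + alpha)]. *)
have -> : (1 + 2 / 5 * (alpha / (1 + alpha))) * (1 + 3 * alpha) * (1 + alpha)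
   = (1 + 7 / 5 * alpha) * (1 + 3 * alpha) by field; rewrite gt_eqF.
nra.
Qed.

Variables (d N : nat) (x : 'I_N -> 'cV[R]_d) (S : {set 'I_N}) (c : option 'I_N).
Variables (H : 'M[R]_d) (alpha eta lambda : R) (W : set 'cV[R]_d) (u w w' w1 : 'cV[R]_d).
Hypothesis Sc : offered S c.
Hypothesis x1 : forall i, norm2 (x i) <= 1.
Hypothesis a0 : 0 < alpha.
Hypothesis eta_lb : 1 + 21 / 5 * alpha <= 2 * eta.
Hypothesis eta_ub : 2 * eta <= 1 + 17 / 4 * alpha.
Hypothesis lambda_lb1 : 72 * eta * alpha <= lambda.
Hypothesis lambda_lb2 : 144 * eta <= lambda.
Hypothesis hH : form_ge lambda H.
Hypothesis cW : convex_set (W : set (convex_lmodType 'cV[R]_d)).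
Hypothesis Wu : W u.
Hypothesis W_le : forall v, W v -> forall o, offered S o -> `|dotv (feature x o) (v - u)| <= alpha.
Hypothesis hw' : is_argmin W (fun v => mxnorm H (v - w)) w'.
Hypothesis hw1 : is_argmin W (fun v =>
  dotv (gradient (mnl_loss x S c) w') v +
  (2 * eta)^-1 * mxnorm (H + eta *: hessian (mnl_loss x S c) w') (v - w') ^+ 2) w1.

Definition mnl_score (o : option 'I_N) : 'cV[R]_d := mnl_mean x S w' - feature x o.
Definition score_norm (o : option 'I_N) : R :=
  dotv (mnl_score o) (invmx H *m mnl_score o).

Let eta0 : 0 < eta. Proof. by move: a0 eta_lb; lra. Qed.
Let lambda0 : 0 < lambda. Proof. by move: eta0 lambda_lb2; lra. Qed.

(** Write [dotv g g] as the product of [g] with the mean minus that with a feature. Both products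
    have square at most [dotv g g], for the mean because a variance is nonnegative; thus
    [dotv g g ^+ 2 <= 4 * dotv g g]. *)
Lemma mnl_score_le o : offered S o -> dotv (mnl_score o) (mnl_score o) <= 4.
Proof.
move=> So; pose g := mnl_score o; rewrite -/g.
have f1 o' : dotv (feature x o') g ^+ 2 <= dotv g g by apply: dotv_feature_le.
have : dotv g g ^+ 2 <= 4 * dotv g g.
  have -> : dotv g g ^+ 2 = (dotv (mnl_mean x S w') g - dotv (feature x o) g) ^+ 2.
    by rewrite -dotvBl.
  have m1 : dotv (mnl_mean x S w') g ^+ 2 <= dotv g g.
    have := form_ge_ge0 g (lexx 0) (mnl_cov_psd x S w').
    rewrite mnl_cov_bilin -expr2 => h.
    have : \sum_(o | offered S o)
       mnl_prob x S w' o * dotv (feature x o) g * dotv (feature x o) g <= dotv g g.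
      rewrite -[leRHS]mul1r -(mnl_prob_sum x S w') mulr_suml ler_sum // => o' _.
      by rewrite -mulrA -expr2 ler_wpM2l ?mnl_prob_ge0.
    lra.
  have := f1 o; set p := dotv (mnl_mean _ _ _) g in m1 *; set q := dotv (feature x o) g.
  have : 0 <= (p + q) ^+ 2 by rewrite sqr_ge0.
  nra.
have := dotv_ge0 g; move: (dotv g g) => r r0 h.
by rewrite leNgt; apply/negP => r4; nra.
Qed.

Lemma score_norm_ge0 o : 0 <= score_norm o.
Proof. exact: invform_ge0 lambda0 hH. Qed.

Lemma score_norm_le o : offered S o -> score_norm o <= 4 / lambda.
Proof.
move=> So; apply: le_trans (invform_le _ lambda0 hH) _.
by rewrite ler_pM2r ?invr_gt0 // mnl_score_le.
Qed.

Let G := mnl_cov x S w'.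
Let Ht := H + eta *: G.
Let z := score_norm c.
Let g := mnl_score c.

Let hHt : form_ge 0 Ht.
Proof.
rewrite -[0](addr0 0); apply: form_geD; first exact: form_geW (ltW lambda0) hH.
by rewrite -(mulr0 eta); apply: form_geZ (ltW eta0) _; exact: mnl_cov_psd.
Qed.

Let HtE y v : dotv y (Ht *m v) = dotv y (H *m v) + eta * dotv y (G *m v).
Proof. by rewrite mulmxDl dotvDr -scalemxAl dotvZr. Qed.

Lemma omd_optimality v : W v -> 0 <= eta * dotv g (v - w1) + dotv (v - w1) (Ht *m (w1 - w')).
Proof.
move=> Wv; have : is_argmin W (fun y => dotv g y + (2 * eta)^-1 * dotv (y - w') (Ht *m (y - w'))) w1.
  move: hw1; rewrite mnl_gradient // mnl_hessian // => -[h1 h2]; split=> // y Wy.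
  by have := h2 y Wy; rewrite !mxnorm_sqr.
have k0 : 0 <= (2 * eta)^-1 by rewrite invr_ge0 mulr_ge0 // ltW.
move=> /(quad_argmin cW hHt k0 Wv).
rewrite -(pmulr_rge0 _ eta0) mulrDr; congr (_ <= _ + _); field.
by rewrite gt_eqF.
Qed.

Let D := w1 - w'.
Let X := dotv D (H *m D).

(** Testing optimality at [w'] gives [X <= eta * - dotv g D], and Cauchy-Schwarz between dual norms
    gives [dotv g D ^+ 2 <= z * X]; together they yield both bounds. *)
Lemma step_bounds : X <= eta ^+ 2 * z /\ - dotv g D <= eta * z.
Proof.
have X0 : 0 <= X by exact: form_ge_ge0 (ltW lambda0) hH.
have z0 : 0 <= z by exact: score_norm_ge0.
have := omd_optimality hw'.1; rewrite -(opprB w1 w') -/D dotvNr dotvNl.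
rewrite HtE -/X.
have := form_ge_ge0 D (lexx 0) (mnl_cov_psd x S w'); rewrite -/G => G0 h.
have {}h : X <= eta * - dotv g D.
  have : 0 <= eta * dotv D (G *m D) by rewrite mulr_ge0 // ltW.
  by move: h; lra.
have := form_ge_CS (invmx H *m g) D (form_geW (ltW lambda0) hH).
have uH := form_ge_unit lambda0 hH.
rewrite mulmxKV_col // dotv_symC ?hH.1 // mulmxKV_col // -/X.
rewrite (dotvC (invmx H *m g) g) (dotvC D g) -/(score_norm c) -/z => CS.
have y0 : 0 <= - dotv g D by rewrite -(pmulr_rge0 _ eta0); apply: le_trans h.
move: CS h y0; rewrite -sqrrN; move: (- dotv g D) => y CS h y0.
have : y <= eta * z.
  move: y0; rewrite le_eqVlt => /predU1P[<-|y0]; first by rewrite mulr_ge0 // ltW.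
  rewrite -(ler_pM2r y0) -expr2; apply: le_trans CS _.
  have : z * X <= z * (eta * y) by rewrite ler_wpM2l.
  lra.
move=> yz; split=> //; apply: le_trans h _.
by rewrite expr2 -mulrA ler_wpM2l // ltW.
Qed.

Let rho := norm2 D.

(** The first bound and [z <= 4 / lambda] give [lambda * rho <= 2 * eta], and [144 * eta <= lambda]
    gives the number. So short a step keeps the laws at [w'] and [w1] comparable. *)
Lemma step_norm_le : lambda * rho ^+ 2 <= eta ^+ 2 * z /\ rho <= 72^-1.
Proof.
have [Xz _] := step_bounds.
have h : lambda * rho ^+ 2 <= eta ^+ 2 * z.
  by apply: le_trans Xz; rewrite norm2_sqr; exact: hH.2.
split=> //.
have z4 : z * lambda <= 4 by rewrite -ler_pdivlMr //; exact: score_norm_le.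
have l0 := lambda0; have e0 := eta0.
have h2 : lambda * rho <= 2 * eta.
  rewrite -(@ler_pXn2r _ 2) ?nnegrE ?mulr_ge0 ?norm2_ge0 ?(ltW l0) ?(ltW e0) //.
  rewrite exprMn expr2 -mulrA; apply: le_trans (_ : lambda * (eta ^+ 2 * z) <= _).
    by rewrite ler_pM2l.
  have -> : lambda * (eta ^+ 2 * z) = eta ^+ 2 * (z * lambda) by ring.
  have -> : (2 * eta) ^+ 2 = eta ^+ 2 * 4 by ring.
  by rewrite ler_wpM2l ?sqr_ge0.
rewrite -(ler_pM2l l0); apply: le_trans h2 _.
by have := lambda_lb2; lra.
Qed.

Lemma step_feature_le o : `|dotv (feature x o) D| <= 72^-1.
Proof.
apply: le_trans (step_norm_le).2.
rewrite -(@ler_pXn2r _ 2) ?nnegrE ?norm2_ge0 //.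
by rewrite real_normK ?num_real // norm2_sqr dotv_feature_le.
Qed.

Lemma omd_round s v : s = alpha / (1 + alpha) -> v = u + s *: (w' - u) ->
  dotv (w1 - u) ((H + mnl_cov x S w1) *m (w1 - u)) <=
  dotv (w - u) (H *m (w - u)) +
  2 * eta / s * (ln (mnl_prob x S v c) - ln (mnl_prob x S u c) + 2 * eta * z).
Proof.
move=> sE vE0; have := (a0, eta0, lambda0); move=> [[a0' eta0'] lambda0'].
have [l72 lc kappa] := step_constants a0 eta_lb eta_ub lambda_lb1 lambda_lb2.
rewrite -sE in kappa.
have a1 : 0 < 1 + alpha by lra.
have s0 : 0 < s by rewrite sE divr_gt0.
have s1 : s < 1 by rewrite sE ltr_pdivrMr //; lra.
have psH := form_geW (ltW lambda0) hH.
set rhs := 2 * eta / s * _.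
(* Replacing [w] by its projection [w'] does not increase the [H]-distance to [u]. *)
suff h : dotv (w1 - u) ((H + mnl_cov x S w1) *m (w1 - u))
         <= dotv (w' - u) (H *m (w' - u)) + rhs.
  by apply: le_trans h _; rewrite lerD2r; exact: projection_le cW psH Wu hw'.
rewrite {}/rhs.
have psG := mnl_cov_psd x S w'.
have hD' o : offered S o -> `|dotv (feature x o) (w' - u)| <= alpha.
  exact: W_le hw'.1 o.
have [hl r72] := step_norm_le; have [Xz gz] := step_bounds.
have X0 : 0 <= X by exact: form_ge_ge0 (ltW lambda0) hH.
have r0 : 0 <= rho by exact: norm2_ge0.
have gap := mnl_mean_gap vE0 (ltW s0) s1 hD'.
have conc := ln_mnl_prob_concave x S u v c.
have opt := omd_optimality Wu.
(* The Hessian entering the next matrix sits at [w1]; changing it to [G] costs the factor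
   [expR (2 * rho)], close to one. *)
have ratio : dotv (w1 - u) (mnl_cov x S w1 *m (w1 - u))
    <= expR (2 * rho) * dotv (w1 - u) (G *m (w1 - u)).
  apply: mnl_cov_ratio => o _.
  rewrite -(@ler_pXn2r _ 2) ?nnegrE //.
  by rewrite real_normK ?num_real // norm2_sqr dotv_feature_le.
have DE : w1 - u = (w' - u) + D by rewrite [RHS]addrC addrA subrK.
set D' := w' - u in DE gap hD' *.
set V := dotv D' (G *m D').
set k := dotv D' (G *m D).
set qq := dotv D (G *m D).
have V0 : 0 <= V by exact: form_ge_ge0 (lexx 0) psG.
have qq0 : 0 <= qq by exact: form_ge_ge0 (lexx 0) psG.
have qqr : qq <= rho ^+ 2.
  by apply: mnl_cov_le_sqr => o _;
    rewrite -(@ler_pXn2r _ 2) ?nnegrE // real_normK ?num_real // norm2_sqr dotv_feature_le.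
have Va : V <= alpha ^+ 2 by apply: mnl_cov_le_sqr.
(* [sv] is the [G]-seminorm of [w' - u], in terms of which [round_error] bounds the cross term
   [k]. *)
pose sv := Num.sqrt V.
have svV : sv ^+ 2 = V by rewrite sqr_sqrtr.
have sv0 : 0 <= sv by exact: sqrtr_ge0.
have sva : sv <= alpha.
  by rewrite -(@ler_pXn2r _ 2) ?nnegrE ?svV // ltW.
have kr : `|k| <= sv * rho.
  rewrite -(@ler_pXn2r _ 2) ?nnegrE ?mulr_ge0 // real_normK ?num_real //.
  rewrite exprMn svV; apply: le_trans (form_ge_CS D' D psG) _.
  by rewrite ler_wpM2l.
have e1 : 1 <= expR (2 * rho) by have := expR_ge1Dx (2 * rho); apply: le_trans; rewrite lerDl mulr_ge0.
have e2 : expR (2 * rho) <= 1 + 4 * rho by exact: expR_le1D4x.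
have := @round_error alpha eta lambda s z sv k qq rho (expR (2 * rho)) s0 (ltW s1)
  sv0 sva kr qq0 qqr r0 r72 e1 e2 eta0 hl l72 lc.
rewrite svV => err.
have E1 : dotv (w1 - u) (G *m (w1 - u)) = V + 2 * k + qq.
  by rewrite DE form_expand // psG.1.
have E2 : dotv (w1 - u) (H *m (w1 - u))
    = dotv D' (H *m D') + 2 * dotv (w1 - u) (H *m D) - X.
  rewrite DE form_expand ?psH.1 // dotvDl -/X; ring.
have E3 : dotv (w1 - u) (G *m D) = k + qq by rewrite DE dotvDl.
have E4 : dotv g (w1 - u) = dotv g D' + dotv g D by rewrite DE [LHS]dotvDr.
have {}opt : 0 <= eta * - (dotv (mnl_mean x S w') D' - dotv (feature x c) D' + dotv g D)
    + - (dotv (w1 - u) (H *m D) + eta * (k + qq)).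
  by move: opt; rewrite -(opprB w1 u) dotvNr dotvNl HtE E3 E4 [dotv g D']dotvBl.
(* The gap between the means pays for the quadratic term [V], with [2 / 5 * s] to spare. *)
have slack : (1 + 2 / 5 * s) * V
    <= 2 * eta * (dotv (mnl_mean x S w') D' - dotv (mnl_mean x S v) D').
  apply: le_trans (_ : 2 * eta / (1 + 3 * alpha) * V <= _).
    by rewrite ler_wpM2r.
  rewrite -dotvBl -mulrA ler_wpM2l ?mulr_ge0 ?(ltW eta0') //.
  apply: le_trans gap; rewrite le_eqVlt; apply/orP; left; apply/eqP.
  by congr (_ * _); rewrite sE; exact: step_coefE.
have {}conc : s * (dotv (feature x c) D' - dotv (mnl_mean x S v) D')
    <= ln (mnl_prob x S v c) - ln (mnl_prob x S u c).
  have vE : u - v = - (s *: D') by rewrite vE0 opprD addrA subrr add0r.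
  move: conc; rewrite vE dotvNr dotvZr dotvBl -(opprB (ln (mnl_prob x S v c))).
  by rewrite lerN2.
have {}ratio : dotv (w1 - u) (mnl_cov x S w1 *m (w1 - u)) <= expR (2 * rho) * (V + 2 * k + qq).
  by rewrite -[V + 2 * k + qq]E1; exact: ratio.
have -> : dotv (w1 - u) ((H + mnl_cov x S w1) *m (w1 - u))
   = dotv (w1 - u) (H *m (w1 - u)) + dotv (w1 - u) (mnl_cov x S w1 *m (w1 - u)).
  by rewrite mulmxDl dotvDr.
exact: round_combine eta0' s0 X0 qq0 opt E2 ratio err slack conc gz.
Qed.

(** The trace of [H^-1 G], written as the mean of the squared dual norm of the gradient under the
    law at [w']. *)
Definition score_trace : R :=
  \sum_(o | offered S o) mnl_prob x S w' o * score_norm o.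

(** The matrix update uses the covariance at [w1], so the features are recentered there and the law
    at [w'] is replaced by that at [w1], at the cost of a factor 2. Then [trace_le_ln_det] applies
    to the centered features scaled by the roots of their probabilities; [8] is [2 * 4]. *)
Lemma score_trace_le :
  score_trace <= 8 * (ln (\det (H + mnl_cov x S w1)) - ln (\det H)).
Proof.
have [l72 _ _] := step_constants a0 eta_lb eta_ub lambda_lb1 lambda_lb2.
have l1 : 1 <= lambda by apply: le_trans l72; lra.
pose m1 := mnl_mean x S w1; pose iH := invmx H.
have psI : form_ge 0 iH by exact: form_ge_invmx lambda0 hH.
pose v o := Num.sqrt (mnl_prob x S w1 o) *: (feature x o - m1).
have covE : mnl_cov x S w1 = \sum_(o | offered S o) v o *m (v o)^T.
  apply: eq_bigr => o _; rewrite linearZ /= -scalemxAl -scalemxAr scalerA -expr2.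
  by rewrite sqr_sqrtr ?mnl_prob_ge0.
have pE o : dotv (v o) (iH *m v o)
    = mnl_prob x S w1 o * dotv (feature x o - m1) (iH *m (feature x o - m1)).
  rewrite -scalemxAr dotvZl dotvZr mulrA -expr2.
  by rewrite sqr_sqrtr ?mnl_prob_ge0.
have := @trace_le_ln_det R d lambda H _ (offered S) v l1 hH.
rewrite -covE => h; have {}h := h _.
apply: le_trans (_ : 2 * \sum_(o | offered S o) dotv (v o) (iH *m v o) <= _); last first.
  have -> : 8 * (ln (\det (H + mnl_cov x S w1)) - ln (\det H))
    = 2 * (4 * (ln (\det (H + mnl_cov x S w1)) - ln (\det H))) by ring.
  rewrite ler_pM2l //; apply: h => y.
  apply: le_trans (mnl_cov_le_id S w1 y x1).
  rewrite mnl_cov_form le_eqVlt; apply/orP; left; apply/eqP.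
  by apply: eq_bigr => o _; rewrite dotvZl exprMn sqr_sqrtr ?mnl_prob_ge0.
have -> : score_trace = \sum_(o | offered S o) mnl_prob x S w' o *
    dotv (feature x o - mnl_mean x S w') (iH *m (feature x o - mnl_mean x S w')).
  apply: eq_bigr => o _; rewrite /score_norm /mnl_score.
  by rewrite -(opprB (feature x o)) mulmxN dotvNl dotvNr opprK.
apply: le_trans (mnl_mean_minimizes x S w' m1 psI) _.
rewrite mulr_sumr ler_sum // => o So; rewrite pE mulrA.
rewrite ler_wpM2r ?(form_ge_ge0 _ (lexx 0) psI) //.
have r2 : mnl_prob x S w' o <= expR (2 * 72^-1) * mnl_prob x S w1 o.
  apply: mnl_prob_ratio => // o' _.
  by rewrite -opprB dotvNr normrN; exact: step_feature_le.
apply: le_trans r2 _; rewrite ler_wpM2r ?mnl_prob_ge0 //.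
apply: le_trans (expR_le1D4x _ (lexx _)) _; lra.
Qed.

(* The tilted probabilities are controlled by those at [w'] because [(1 - s) alpha <= 1]. *)
Lemma tilted_mass_le1 s v : s = alpha / (1 + alpha) -> v = u + s *: (w' - u) ->
  \sum_(o | offered S o) mnl_prob x S u o *
    (mnl_prob x S v o / mnl_prob x S u o
     * expR (2 * eta * score_norm o - 4 * eta * expR 2 * score_trace)) <= 1.
Proof.
move=> sE vE; have [[e0 l0] l144] := (eta0, lambda0, lambda_lb2).
have a1 : 0 < 1 + alpha by have := a0; lra.
have tilt o : offered S o -> mnl_prob x S v o <= expR 2 * mnl_prob x S w' o.
  move=> So; rewrite -[2]mulr1; apply: mnl_prob_ratio => // o' So'.
  have -> : v - w' = - ((1 - s) *: (w' - u)).
    by rewrite vE scalerBl scale1r opprB opprB addrCA addrA -addrA addrC; congr (_ + _).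
  rewrite dotvNr normrN dotvZr normrM.
  have -> : 1 - s = (1 + alpha)^-1 by rewrite sE; field; rewrite gt_eqF.
  rewrite gtr0_norm ?invr_gt0 // mulrC ler_pdivrMr // mul1r.
  apply: le_trans (W_le hw'.1 So') _; lra.
(* The factor [4 * eta] comes from [expR y <= 1 + 2 * y] at [y = 2 * eta * score_norm o], and
   [expR 2] from [tilt]. The mass before compensation is at most [1 + K], which [expR (- K)] brings
   below one. *)
pose K := 4 * eta * expR 2 * score_trace.
apply: le_trans (_ : (1 + K) * expR (- K) <= _); last first.
  rewrite expRN ler_pdivrMr ?expR_gt0 // mul1r; exact: expR_ge1Dx.
have e2 o : offered S o -> expR (2 * eta * score_norm o) <= 1 + 4 * eta * score_norm o.
  move=> So; have z0 := score_norm_ge0 o; have z4 := score_norm_le So.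
  have -> : 1 + 4 * eta * score_norm o = 1 + 2 * (2 * eta * score_norm o) by ring.
  apply: expR_le1D2x; first by rewrite !mulr_ge0 // ltW.
  apply: le_trans (_ : 2 * eta * (4 / lambda) <= _); first by rewrite ler_pM2l ?mulr_gt0.
  rewrite mulrA ler_pdivrMr //; lra.
apply: le_trans (_ : \sum_(o | offered S o)
    (mnl_prob x S v o + 4 * eta * expR 2 * (mnl_prob x S w' o * score_norm o)) * expR (- K) <= _).
  apply: ler_sum => o So; rewrite mulrA [mnl_prob x S u o * _]mulrC divfK; last first.
    by rewrite gt_eqF // mnl_prob_gt0.
  rewrite expRD mulrA ler_pM2r ?expR_gt0 //.
  apply: le_trans (ler_wpM2l (mnl_prob_ge0 _ _ _ _) (e2 o So)) _.
  rewrite mulrDr mulr1 lerD2l.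
  have := ler_wpM2r (score_norm_ge0 o) (tilt o So).
  have e4 : 0 < 4 * eta by rewrite mulr_gt0.
  rewrite -(ler_pM2l e4); congr (_ <= _); ring.
by rewrite -mulr_suml big_split /= mnl_prob_sum -mulr_sumr.
Qed.

End Round.

(** * Measurability *)

Section SubSigmaAlgebra.
Variables (disp : measure_display) (Omega : measurableType disp) (R : realType).
Variable G : set (set Omega).
Hypothesis sG : sigma_algebra setT G.

(** As [G] is already a sigma-algebra, generating from it changes nothing, and
    [g_sigma_algebraType G] makes the lemmas on measurable functions available relative to [G]. *)
Lemma meas_realP (f : Omega -> R) :
  meas_real G f <-> measurable_fun setT (f : g_sigma_algebraType G -> R).
Proof.
have GE : <<s G >> = G by exact: sigma_algebra_id.
split=> [h _ Y mY|h A mA]; first by rewrite setTI /measurable /= GE; exact: h.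
by have := h measurableT A mA; rewrite setTI /measurable /= GE.
Qed.

Lemma meas_discreteP (I : finType) (f : Omega -> I) : meas_discrete G f ->
  forall a, measurable ([set w | f w = a] : set (g_sigma_algebraType G)).
Proof.
have GE : <<s G >> = G by exact: sigma_algebra_id.
by move=> h a; rewrite /measurable /= GE; exact: h.
Qed.

End SubSigmaAlgebra.

Section Measurability.
Variables (R : realType) (disp : measure_display) (T : measurableType disp).

Lemma measurable_fun_discrete (I : finType) (disp' : measure_display)
    (T' : measurableType disp') (f : T -> I) (h : I -> T') :
  (forall a, measurable [set t | f t = a]) -> measurable_fun setT (h \o f).
Proof.
move=> mf _ Y mY; rewrite setTI.
rewrite (_ : _ @^-1` Y = \big[setU/set0]_(a <- enum I | `[< Y (h a) >]) [set t | f t = a]).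
  by apply: bigsetU_measurable => a _; exact: mf.
apply/seteqP; split=> [t /= Yt|t].
  rewrite -bigcup_seq_cond; exists (f t) => //=.
  by rewrite mem_enum; apply/andP; split=> //; exact/asboolP.
rewrite -bigcup_seq_cond => -[a /= /andP[_ /asboolP Ya]] fta.
by rewrite /= fta.
Qed.

Lemma measurable_inv (f : T -> R) : (forall t, 0 < f t) -> measurable_fun setT f ->
  measurable_fun setT (fun t => (f t)^-1).
Proof.
move=> f0 mf; rewrite (_ : (fun t => _) = expR \o (fun t => - ln (f t))).
  apply: measurableT_comp; first exact: measurable_expR.
  apply: measurableT_comp => //; apply: measurableT_comp => //; exact: measurable_ln.
by apply/funext => t /=; rewrite expRN lnK ?posrE.
Qed.

Lemma measurable_sum_cond (I : finType) (P : T -> pred I) (f : I -> T -> R) :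
  (forall i, measurable_fun setT (P ^~ i)) -> (forall i, measurable_fun setT (f i)) ->
  measurable_fun setT (fun t => \sum_(i | P t i) f i t).
Proof.
move=> mP mf; under eq_fun do rewrite big_mkcond.
apply: measurable_sum => i; apply: measurable_fun_ifT => //.
Qed.

Definition meas_mx m n (A : T -> 'M[R]_(m, n)) :=
  forall i j, measurable_fun setT (fun t => A t i j).

Lemma meas_mxD m n (A B : T -> 'M[R]_(m, n)) : meas_mx A -> meas_mx B ->
  meas_mx (fun t => A t + B t).
Proof.
by move=> mA mB i j; under eq_fun do rewrite mxE; exact: measurable_funD.
Qed.

Lemma meas_mxB m n (A B : T -> 'M[R]_(m, n)) : meas_mx A -> meas_mx B ->
  meas_mx (fun t => A t - B t).
Proof.
move=> mA mB i j; under eq_fun do rewrite !mxE.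
exact: measurable_funB.
Qed.

Lemma meas_mxZ m n (a : T -> R) (A : T -> 'M[R]_(m, n)) : measurable_fun setT a ->
  meas_mx A -> meas_mx (fun t => a t *: A t).
Proof.
by move=> ma mA i j; under eq_fun do rewrite mxE; exact: measurable_funM.
Qed.

Lemma meas_mx_cst m n (A : 'M[R]_(m, n)) : meas_mx (fun=> A).
Proof. by move=> i j; exact: measurable_cst. Qed.

Lemma meas_mxM m n p (A : T -> 'M[R]_(m, n)) (B : T -> 'M[R]_(n, p)) :
  meas_mx A -> meas_mx B -> meas_mx (fun t => A t *m B t).
Proof.
move=> mA mB i j; under eq_fun do rewrite mxE.
by apply: measurable_sum => k; exact: measurable_funM.
Qed.

Lemma meas_mx_tr m n (A : T -> 'M[R]_(m, n)) : meas_mx A -> meas_mx (fun t => (A t)^T).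
Proof. by move=> mA i j; under eq_fun do rewrite mxE; exact: mA. Qed.

Lemma meas_mx_sum m n (I : finType) (P : T -> pred I) (A : I -> T -> 'M[R]_(m, n)) :
  (forall i, measurable_fun setT (P ^~ i)) -> (forall i, meas_mx (A i)) ->
  meas_mx (fun t => \sum_(i | P t i) A i t).
Proof.
move=> mP mA i j; under eq_fun do rewrite summxE.
by apply: measurable_sum_cond => // k; exact: mA.
Qed.

Lemma measurable_dotv d (u v : T -> 'cV[R]_d) : meas_mx u -> meas_mx v ->
  measurable_fun setT (fun t => dotv (u t) (v t)).
Proof.
move=> mu mv; under eq_fun do rewrite dotvE.
by apply: measurable_sum => i; exact: measurable_funM.
Qed.

Lemma measurable_det n (A : T -> 'M[R]_n) : meas_mx A ->
  measurable_fun setT (fun t => \det (A t)).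
Proof.
move=> mA; rewrite /determinant; apply: measurable_sum => s.
apply: measurable_funM; first exact: measurable_cst.
by apply: measurable_prod => i _; exact: mA.
Qed.

(* The inverse of [H] is measurable since [det_rank1] expresses the form through determinants. *)
Lemma measurable_invform d c (H : T -> 'M[R]_d) (g : T -> 'cV[R]_d) : 0 < c ->
  (forall t, form_ge c (H t)) -> meas_mx H -> meas_mx g ->
  measurable_fun setT (fun t => dotv (g t) (invmx (H t) *m g t)).
Proof.
move=> c0 hH mH mg.
rewrite (_ : (fun t => _) =
  (fun t => \det (H t + g t *m (g t)^T) * (\det (H t))^-1 - 1)); last first.
  apply/funext => t; rewrite det_rank1 ?(form_ge_unit c0) // mulrAC divff.
    by rewrite mul1r addrC addKr.
  by rewrite gt_eqF // (form_ge_det_gt0 c0).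
apply: measurable_funB; last exact: measurable_cst.
apply: measurable_funM.
  by apply/measurable_det/meas_mxD => //; apply: meas_mxM => //; exact: meas_mx_tr.
apply: measurable_inv; last exact: measurable_det.
by move=> t; exact: form_ge_det_gt0 c0 (hH t).
Qed.

Variables (d N : nat) (x : T -> 'I_N -> 'cV[R]_d) (S : T -> {set 'I_N}).
Hypothesis mx : forall i, meas_mx (fun t => x t i).
Hypothesis mS : forall a, measurable [set t | S t = a].

Lemma measurable_offered o : measurable_fun setT (fun t => offered (S t) o).
Proof. exact: (measurable_fun_discrete (fun s : {set 'I_N} => offered s o)). Qed.

Lemma meas_feature o : meas_mx (fun t => feature (x t) o).
Proof. by case: o => [i|]; [exact: mx|exact: meas_mx_cst]. Qed.

Variable (w : T -> 'cV[R]_d).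
Hypothesis mw : meas_mx w.

Lemma measurable_mnl_prob o : measurable_fun setT (fun t => mnl_prob (x t) (S t) (w t) o).
Proof.
have me o' : measurable_fun setT (fun t => expR (dotv (feature (x t) o') (w t))).
  apply: measurableT_comp; first exact: measurable_expR.
  by apply: measurable_dotv => //; exact: meas_feature.
under eq_fun do rewrite mnl_probE.
apply: measurable_funM => //; apply: measurable_inv => [t|].
  exact: mnl_weight_gt0.
by apply: measurable_sum_cond => // o'; exact: measurable_offered.
Qed.

Lemma meas_mnl_mean : meas_mx (fun t => mnl_mean (x t) (S t) (w t)).
Proof.
apply: meas_mx_sum => o; first exact: measurable_offered.
by apply: meas_mxZ; [exact: measurable_mnl_prob|exact: meas_feature].
Qed.

Lemma meas_mnl_cov : meas_mx (fun t => mnl_cov (x t) (S t) (w t)).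
Proof.
have mf o : meas_mx (fun t => feature (x t) o - mnl_mean (x t) (S t) (w t)).
  by apply: meas_mxB; [exact: meas_feature|exact: meas_mnl_mean].
apply: meas_mx_sum => o; first exact: measurable_offered.
apply: meas_mxZ; first exact: measurable_mnl_prob.
by apply: meas_mxM => //; exact: meas_mx_tr.
Qed.

End Measurability.

(** * Conditional laws and Ville's inequality *)

Section CondProb.
Import HBNNSimple.
Variables (disp : measure_display) (Omega : measurableType disp) (R : realType).
Variable P : probability Omega R.
Variable G : set (set Omega).
Hypothesis sG : sigma_algebra setT G.
Hypothesis Gm : G `<=` measurable.

Lemma meas_real_measurable (f : Omega -> R) : meas_real G f -> measurable_fun setT f.
Proof. by move=> mf _ Y mY; rewrite setTI; apply: Gm; exact: mf. Qed.

(** The definition covers indicators of sets of [G]; linearity extends it to simple functions and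
    monotone convergence to nonnegative ones. The approximants are built on [g_sigma_algebraType G],
    so their level sets belong to [G]. *)
Lemma cond_prob_integral (E : set Omega) (q f : Omega -> R) :
  measurable E -> is_cond_prob P G E q -> (forall w, 0 <= q w) ->
  meas_real G f -> (forall w, 0 <= f w) ->
  (\int[P]_w (f w * \1_E w)%:E = \int[P]_w (f w * q w)%:E)%E.
Proof.
move=> mE [mq hq] q0 mf f0.
have mqO := meas_real_measurable mq.
have mE1 : measurable_fun setT (\1_E : Omega -> R) by exact: measurable_indic.
pose GT : measurableType _ := g_sigma_algebraType G.
have mfG : measurable_fun setT (EFin \o f : GT -> \bar R).
  by apply/measurable_EFinP; apply/(meas_realP sG).
have f0E (w : GT) : setT w -> (0 <= (EFin \o f) w)%E by move=> _; rewrite lee_fin.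
pose h n : GT -> R := nnsfun_approx measurableT mfG n.
have h0 n w : 0 <= h n w by exact: fun_ge0.
have GE : <<s G >> = G by exact: sigma_algebra_id.
have mhG n A : measurable A -> G (h n @^-1` A).
  move=> mA; have := @measurable_funPT _ _ _ _ (nnsfun_approx measurableT mfG n) measurableT A mA.
  by rewrite setTI /measurable /= GE.
have mh n : measurable_fun setT (h n : Omega -> R).
  by move=> _ A mA; rewrite setTI; apply: Gm; exact: mhG.
have cvgh w : (EFin \o h ^~ w) n @[n --> \oo] --> (f w)%:E.
  exact: (cvg_nnsfun_approx measurableT mfG f0E (x := w) I).
have ndh w : {homo (h ^~ w) : n m / (n <= m)%N >-> n <= m}.
  by move=> n m nm; have /lefP/(_ w) := nd_nnsfun_approx measurableT mfG nm.
have lim_int (k : Omega -> R) : measurable_fun setT k -> (forall w, 0 <= k w) ->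
    (\int[P]_w (f w * k w)%:E = limn (fun n => \int[P]_w (h n w * k w)%:E))%E.
  move=> mk k0; rewrite -monotone_convergence //.
  - apply: eq_integral => w _; apply/esym/cvg_lim => //.
    under eq_fun do rewrite EFinM; rewrite EFinM.
    by apply: cvgeZr => //; exact: cvgh.
  - by move=> n; apply/measurable_EFinP; exact: measurable_funM.
  - by move=> n w _; rewrite lee_fin mulr_ge0.
  - by move=> w _ n m nm; rewrite lee_fin ler_wpM2r // ndh.
rewrite !lim_int //.
congr (limn _); apply/funext => n.
have [m [a [a0 hE]]] : exists m, exists a : 'I_m -> R, (forall i, 0 <= a i) /\
    forall w, h n w = \sum_(i < m) a i * \1_(h n @^-1` [set a i]) w.
  have fin : finite_set (range (h n)) by exact: fimfunP.
  eexists; exists (fun i => (fset_set (range (h n)))`_i).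
  split=> [i|w]; last exact: (fimfunEord (nnsfun_approx measurableT mfG n)).
  have : (fset_set (range (h n)))`_i \in fset_set (range (h n)) by exact: mem_nth.
  by rewrite in_fset_set // inE => -[w _ <-].
pose A i : set Omega := h n @^-1` [set a i].
have GA i : G (A i) by exact: mhG.
have mA i : measurable (A i : set Omega) by apply: Gm; exact: GA.
have mI i : measurable_fun setT (\1_(A i) : Omega -> R) by exact: measurable_indic.
have simple (k : Omega -> R) : measurable_fun setT k -> (forall w, 0 <= k w) ->
   (\int[P]_w (h n w * k w)%:E =
    \sum_(i < m) (a i)%:E * \int[P]_w (\1_(A i) w * k w)%:E)%E.
  move=> mk k0.
  transitivity (\int[P]_w \sum_(i < m) (a i)%:E * (\1_(A i) w * k w)%:E)%E.
    apply: eq_integral => w _; rewrite hE mulr_suml -sumEFin.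
    by apply: eq_bigr => i _; rewrite -EFinM mulrA.
  have mIk i : measurable_fun (setT : set Omega) (fun w : Omega => (\1_(A i) w * k w)%:E).
    by apply/measurable_EFinP; exact: measurable_funM.
  rewrite ge0_integral_sum //.
  - apply: eq_bigr => i _; rewrite ge0_integralZl // ?lee_fin // => w _.
    by rewrite lee_fin mulr_ge0.
  - by move=> i; apply: measurable_funeM.
  - by move=> i w _; rewrite -EFinM lee_fin !mulr_ge0.
rewrite !simple //; apply: eq_bigr => i _; congr (_ * _)%E.
transitivity (P (A i `&` E)).
  rewrite -[X in P X]setIT -integral_indic //; last exact: measurableI.
  by apply: eq_integral => w _; rewrite indicI.
rewrite hq // integral_mkcond; apply: eq_integral => w _.
by rewrite epatch_indic /= -EFinM mulrC.
Qed.

(** The one-step supermartingale inequality. After splitting over the value of [c], each term has a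
    [G]-measurable factor [f * Z o], so the indicator of [c = o] may be replaced by [q o]. *)
Lemma expectation_choice_le (I : finType) (c : Omega -> I) (q Z : I -> Omega -> R)
    (f : Omega -> R) :
  (forall o, measurable [set w | c w = o]) ->
  (forall o, is_cond_prob P G [set w | c w = o] (q o)) ->
  (forall o w, 0 <= q o w) -> (forall o w, 0 <= Z o w) -> (forall o, meas_real G (Z o)) ->
  meas_real G f -> (forall w, 0 <= f w) ->
  (forall w, \sum_o q o w * Z o w <= 1) ->
  (\int[P]_w (f w * Z (c w) w)%:E <= \int[P]_w (f w)%:E)%E.
Proof.
move=> mc hq q0 Z0 mZ mf f0 le1.
have mfO := meas_real_measurable mf.
have mZO o := meas_real_measurable (mZ o).
have mqO o : measurable_fun setT (q o) by apply: meas_real_measurable; case: (hq o).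
have mfZ o : meas_real G (fun w => f w * Z o w).
  by apply/(meas_realP sG); apply: measurable_funM; apply/(meas_realP sG).
apply: le_trans (_ : (\int[P]_w \sum_o (f w * Z o w * q o w)%:E <= _)%E).
  rewrite le_eqVlt; apply/orP; left; apply/eqP.
  transitivity (\int[P]_w \sum_o (f w * Z o w * \1_[set v | c v = o] w)%:E)%E.
    apply: eq_integral => w _; rewrite sumEFin (bigD1 (c w)) //= big1 ?addr0.
      by rewrite indicE mem_set ?mulr1.
    move=> o oc; rewrite indicE memNset ?mulr0 //= => co.
    by move: oc; rewrite co eqxx.
  rewrite !ge0_integral_sum //.
  - apply: eq_bigr => o _; apply: cond_prob_integral => //.
    by move=> w; rewrite mulr_ge0.
  - by move=> o; apply/measurable_EFinP; apply: measurable_funM => //; apply: measurable_funM.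
  - by move=> o w _; rewrite lee_fin !mulr_ge0.
  - move=> o; apply/measurable_EFinP; apply: measurable_funM; first exact: measurable_funM.
    exact: measurable_indic.
  - by move=> o w _; rewrite lee_fin !mulr_ge0.
apply: ge0_le_integral => //.
- by move=> w _; apply: sume_ge0 => o _; rewrite lee_fin !mulr_ge0.
- apply: emeasurable_sum => o; apply/measurable_EFinP; apply: measurable_funM => //.
  exact: measurable_funM.
- exact/measurable_EFinP.
move=> w _; rewrite sumEFin lee_fin.
under eq_bigr do rewrite -mulrA [_ * q _ w]mulrC.
by rewrite -mulr_sumr ler_piMr.
Qed.
End CondProb.

Section Ville.
Variables (disp : measure_display) (Omega : measurableType disp) (R : realType).
Variables (P : probability Omega R) (F : nat -> set (set Omega)) (T : nat).
Variables (I : finType) (c : nat -> Omega -> I) (q Z : nat -> I -> Omega -> R) (k : R).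

(* Freezing the product once it reaches [k] reduces Ville's inequality to Markov's
   inequality at time [T]. *)
Fixpoint stopped_product (n : nat) (w : Omega) : R :=
  if n is m.+1 then
    let M := stopped_product m w in
    M * (if M < k then Z m.+1 (c m.+1 w) w else 1)
  else 1.

(** A value that has reached [k] is multiplied by 1 from then on, so a value below [k] at time [n]
    shows that no freezing has occurred. One event at the final time thus controls all times. *)
Lemma stopped_product_lt n w : stopped_product n w < k ->
  stopped_product n w = \prod_(1 <= t < n.+1) Z t (c t w) w /\
  forall m, (m <= n)%N -> \prod_(1 <= t < m.+1) Z t (c t w) w < k.
Proof.
elim: n => [|n IH] /=.
  by rewrite big_nil => k1; split=> // m; rewrite leqn0 => /eqP->; rewrite big_nil.
case: ifPn => [Mk|]; last by rewrite mulr1 => /negP.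
have [ME Mlt] := IH Mk.
rewrite ME -big_nat_recr //= => h; split=> // m.
by rewrite leq_eqVlt ltnS => /predU1P[->//|/Mlt].
Qed.

Hypothesis filtF : filtration F.
Hypothesis c_adapted : forall t, (1 <= t <= T)%N -> meas_discrete (F t) (c t).
Hypothesis c_law : forall t, (1 <= t <= T)%N -> forall o,
  is_cond_prob P (F t.-1) [set w | c t w = o] (q t o).
Hypothesis q0 : forall t o w, 0 <= q t o w.
Hypothesis q1 : forall t w, (1 <= t <= T)%N -> \sum_o q t o w <= 1.
Hypothesis Z0 : forall t o w, 0 <= Z t o w.
Hypothesis Z_predictable : forall t, (1 <= t <= T)%N -> forall o, meas_real (F t.-1) (Z t o).
Hypothesis qZ1 : forall t w, (1 <= t <= T)%N -> \sum_o q t o w * Z t o w <= 1.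

Lemma stopped_product_ge0 n w : 0 <= stopped_product n w.
Proof. by elim: n => //= n IH; rewrite mulr_ge0 //; case: ifP. Qed.

Lemma meas_realS s t f : (s <= t)%N -> meas_real (F s) f -> @meas_real R Omega (F t) f.
Proof. by move=> st mf A mA; case: filtF => _ _ /(_ s t st); apply; exact: mf. Qed.

Lemma stopped_product_adapted n : (n <= T)%N -> meas_real (F n) (stopped_product n).
Proof.
have [sF _ _] := filtF.
elim: n => [_|n IH nT]; first by apply/(meas_realP (sF 0%N)); exact: measurable_cst.
have nT' : (1 <= n.+1 <= T)%N by [].
have mM : meas_real (F n.+1) (stopped_product n).
  by apply: (@meas_realS n) => //; exact/IH/ltnW.
apply/(meas_realP (sF n.+1)); apply: measurable_funM; first exact/meas_realP.
apply: measurable_fun_ifT; last exact: measurable_cst.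
  by apply: measurable_fun_ltr; [exact/meas_realP|exact: measurable_cst].
(* Evaluation at the random choice becomes a finite sum selected by [c n.+1], measurable term by
   term. *)
under eq_fun => w.
  rewrite (_ : Z _ _ w = \sum_(o | o == c n.+1 w) Z n.+1 o w); last by rewrite big_pred1_eq.
  over.
apply: measurable_sum_cond => o.
  apply: (measurable_fun_discrete (fun a => o == a)).
  exact: meas_discreteP (c_adapted nT').
by apply/(meas_realP (sF n.+1)); apply: (@meas_realS n) => //; exact: Z_predictable nT' o.
Qed.

Lemma expectation_stopped_product n : (n <= T)%N ->
  (\int[P]_w (stopped_product n w)%:E <= 1)%E.
Proof.
have [sF Fm _] := filtF.
elim: n => [_|n IH nT] /=.
  by rewrite integral_cst // mul1e; exact: probability_le1.
have nT' : (1 <= n.+1 <= T)%N by [].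
apply: le_trans (IH (ltnW nT)).
have mM := stopped_product_adapted (ltnW nT).
(* [Z'] has the freezing built in; its weighted mass is at most one by [qZ1] before freezing and by
   [q1] after. *)
pose Z' o w := if stopped_product n w < k then Z n.+1 o w else 1.
have E w : stopped_product n w *
  (if stopped_product n w < k then Z n.+1 (c n.+1 w) w else 1)
  = stopped_product n w * Z' (c n.+1 w) w by [].
under eq_integral do rewrite E.
apply: (expectation_choice_le (sF n) (Fm n) (c := c n.+1) (q := q n.+1)) => //.
- by move=> o; apply: (Fm n.+1); exact: c_adapted.
- exact: c_law nT'.
- by move=> o w; rewrite /Z'; case: ifP.
- move=> o; apply/(meas_realP (sF n)); apply: measurable_fun_ifT; last exact: measurable_cst.
    by apply: measurable_fun_ltr; [exact/meas_realP|exact: measurable_cst].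
  by apply/meas_realP => //; exact: Z_predictable nT' o.
- exact: stopped_product_ge0.
- move=> w; rewrite /Z'; case: (stopped_product n w < k); first exact: qZ1.
  by rewrite (eq_bigr (fun o => q n.+1 o w)) => [|o _]; [exact: q1|rewrite mulr1].
Qed.

Lemma ville : 0 < k ->
  measurable [set w | stopped_product T w < k] /\
  ((1 - k^-1)%:E <= P [set w | (stopped_product T w < k)%R])%E.
Proof.
move=> k0; have [sF Fm _] := filtF.
have mM := meas_real_measurable (Fm T) (stopped_product_adapted (leqnn T)).
have mB : measurable [set w | stopped_product T w < k].
  rewrite (_ : mkset _ = stopped_product T @^-1` `]-oo, k[).
    by rewrite -[X in measurable X]setTI; exact: mM.
  by apply/seteqP; split=> w /=; rewrite in_itv.
split=> //; set B := mkset _ in mB *.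
have mBc : measurable (~` B) by exact: measurableC.
have h : (k%:E * P (~` B) <= 1)%E.
  apply: le_trans (expectation_stopped_product (leqnn T)).
  have m1 : measurable_fun setT (fun w => (\1_(~` B) w)%:E : \bar R).
    by apply/measurable_EFinP; exact: measurable_indic.
  have -> : (k%:E * P (~` B) = \int[P]_w (k%:E * (\1_(~` B) w)%:E))%E.
    rewrite ge0_integralZl ?lee_fin ?ltW //.
    by rewrite integral_indic // setIT.
  apply: ge0_le_integral => //.
  - by move=> w _; rewrite -EFinM lee_fin mulr_ge0 // ltW.
  - exact: measurable_funeM.
  - exact/measurable_EFinP.
  move=> w _; rewrite -EFinM lee_fin indicE.
  case: (boolP (w \in ~` B)) => [|_]; last by rewrite mulr0 stopped_product_ge0.
  by rewrite inE /B /= => /negP; rewrite -leNgt mulr1.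
have PB : P B = (1 - P (~` B))%E by rewrite -probability_setC // setCK.
rewrite PB.
have pf : P (~` B) \is a fin_num by exact: fin_num_measure.
rewrite -(fineK pf) -EFinB lee_fin lerB // -(ler_pM2l k0) divff ?gt_eqF //.
by rewrite -lee_fin EFinM fineK.
Qed.

End Ville.

(** * Summation over the rounds *)

Section Trajectory.
Variables (R : realType) (d N T : nat) (x : nat -> 'I_N -> 'cV[R]_d).
Variables (S : nat -> {set 'I_N}) (c : nat -> option 'I_N) (U : nat -> bool).
Variables (W : nat -> set 'cV[R]_d) (w w' : nat -> 'cV[R]_d) (u : 'cV[R]_d).
Variables (alpha eta lambda : R).

(** [omd_matrix] with the Hessians already evaluated as covariances, so that the choices no longer
    appear explicitly. *)
Definition design (t : nat) : 'M[R]_d :=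
  lambda%:M + \sum_(1 <= s < t | U s) mnl_cov (x s) (S s) (w s.+1).

Definition tilted (t : nat) : 'cV[R]_d := u + (alpha / (1 + alpha)) *: (w' t - u).

(** The multiplicative increment of the supermartingale for a hypothetical choice [o]: predictable
    for fixed [o], it is later evaluated at [c t]. *)
Definition tilt_factor (t : nat) (o : option 'I_N) : R :=
  if U t then
    mnl_prob (x t) (S t) (tilted t) o / mnl_prob (x t) (S t) u o *
    expR (2 * eta * score_norm (x t) (S t) (design t) (w' t) o
          - 4 * eta * expR 2 * score_trace (x t) (S t) (design t) (w' t))
  else 1.

Lemma tilt_factor_gt0 t o : 0 < tilt_factor t o.
Proof.
rewrite /tilt_factor; case: ifP => // _.
by rewrite mulr_gt0 ?expR_gt0 // divr_gt0 // mnl_prob_gt0.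
Qed.

Lemma design_form_ge t : form_ge lambda (design t).
Proof.
rewrite -[X in form_ge X](addr0 lambda); apply: form_geD; first exact: form_ge_scalar.
by apply: form_ge_sum => s _; exact: mnl_cov_psd.
Qed.

Lemma designS t : design t.+2 =
  if U t.+1 then design t.+1 + mnl_cov (x t.+1) (S t.+1) (w t.+2) else design t.+1.
Proof.
rewrite /design [in LHS]big_mkcond big_nat_recr //= -big_mkcond /= addrA.
by case: ifP => _ //; rewrite addr0.
Qed.

Lemma design1 : design 1 = lambda%:M.
Proof. by rewrite /design big_geq // addr0. Qed.

Hypothesis off : forall t, U t -> offered (S t) (c t).

Lemma omd_matrixE t :
  omd_matrix lambda U (fun t => mnl_loss (x t) (S t) (c t)) w t = design t.
Proof.
by congr (_ + _); apply: eq_bigr => s Us; rewrite mnl_hessian // off.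
Qed.

Hypothesis x1 : forall t, U t -> forall i, norm2 (x t i) <= 1.
Hypothesis a0 : 0 < alpha.
Hypothesis eta_lb : 1 + 21 / 5 * alpha <= 2 * eta.
Hypothesis eta_ub : 2 * eta <= 1 + 17 / 4 * alpha.
Hypothesis lambda_lb1 : 72 * eta * alpha <= lambda.
Hypothesis lambda_lb2 : 144 * eta <= lambda.
Hypothesis cW : forall t, U t -> convex_set (W t : set (convex_lmodType 'cV[R]_d)).
Hypothesis Wu : forall t, U t -> W t u.
Hypothesis W_le : forall t, U t -> forall v, W t v -> forall o, offered (S t) o ->
  `|dotv (feature (x t) o) (v - u)| <= alpha.
Hypothesis step : forall t, (1 <= t <= T)%N ->
  omd_step eta lambda U (fun t => mnl_loss (x t) (S t) (c t)) W w w' t.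

Let eta0 : 0 < eta. Proof. by move: a0 eta_lb; lra. Qed.
Let lambda1 : 1 <= lambda. Proof. by move: a0 eta_lb lambda_lb2; lra. Qed.
Let lambda0 : 0 < lambda. Proof. by apply: lt_le_trans lambda1. Qed.
Let s := alpha / (1 + alpha).

Lemma tilt_factor_mass_le1 t : (1 <= t <= T)%N ->
  \sum_(o | offered (S t) o) mnl_prob (x t) (S t) u o * tilt_factor t o <= 1.
Proof.
move=> tT; rewrite /tilt_factor; case: (boolP (U t)) => Ut; last first.
  by under eq_bigr do rewrite mulr1; rewrite mnl_prob_sum.
have := step tT; rewrite /omd_step Ut omd_matrixE => -[hw' _].
exact: (tilted_mass_le1 (x1 Ut) a0 eta_lb lambda_lb2 (design_form_ge t) (W_le Ut) hw' erefl erefl).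
Qed.

(** Sums [omd_round] over the rounds. The logarithm of each factor contains the compensator with a
    minus sign; adding it back and bounding the trace by [score_trace_le] leaves telescoping
    log-determinants, with [32 = 4 * 8]. *)
Lemma trajectory_bound n : (n <= T)%N ->
  dotv (w n.+1 - u) (design n.+1 *m (w n.+1 - u)) <=
  dotv (w 1%N - u) (design 1 *m (w 1%N - u)) +
  2 * eta / s * (ln (\prod_(1 <= t < n.+1) tilt_factor t (c t)) +
    32 * eta * expR 2 * (ln (\det (design n.+1)) - ln (\det (design 1)))).
Proof.
elim: n => [_|n IH nT].
  by rewrite big_geq // ln1 subrr mulr0 addr0 mulr0 addr0.
have {}IH := IH (ltnW nT).
have P0 : 0 < \prod_(1 <= t < n.+1) tilt_factor t (c t).
  by apply: prodr_gt0 => t _; exact: tilt_factor_gt0.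
rewrite big_nat_recr //= lnM ?posrE ?tilt_factor_gt0 //.
have nT' : (1 <= n.+1 <= T)%N by [].
have := step nT'; rewrite /omd_step designS /tilt_factor.
case: ifP => Un; last first.
  by move=> ->; rewrite ln1 addr0; exact: IH.
rewrite omd_matrixE => -[hw' hw1].
have hH := design_form_ge n.+1.
have := omd_round (off Un) (x1 Un) a0 eta_lb eta_ub lambda_lb1 lambda_lb2 hH
  (cW Un) (Wu Un) (W_le Un) hw' hw1 erefl erefl.
have := score_trace_le (off Un) (x1 Un) a0 eta_lb eta_ub lambda_lb1 lambda_lb2 hH
  (cW Un) hw' hw1.
rewrite -/(tilted n.+1) -/s.
set pv := mnl_prob _ _ (tilted _) _; set pu := mnl_prob _ _ u _.
have -> : ln (pv / pu * expR (2 * eta *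
      score_norm (x n.+1) (S n.+1) (design n.+1) (w' n.+1) (c n.+1) -
      4 * eta * expR 2 * score_trace (x n.+1) (S n.+1) (design n.+1) (w' n.+1)))
   = ln pv - ln pu + 2 * eta *
      score_norm (x n.+1) (S n.+1) (design n.+1) (w' n.+1) (c n.+1) -
      4 * eta * expR 2 * score_trace (x n.+1) (S n.+1) (design n.+1) (w' n.+1).
  have pv0 : 0 < pv by exact: mnl_prob_gt0.
  have pu0 : 0 < pu by exact: mnl_prob_gt0.
  rewrite [LHS]lnM ?posrE; [|exact: divr_gt0|exact: expR_gt0].
  by rewrite expRK ln_div ?posrE // addrA.
move: IH; set Q1 := dotv _ _; set Q0 := dotv _ _; set Q2 := dotv _ _.
set z := score_norm _ _ _ _ _; set tr := score_trace _ _ _ _.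
set l2 := ln (\det (design n.+1 + _)); set l1 := ln (\det (design n.+1)).
set l0 := ln (\det (design 1)); set L := ln (\prod_(_ <= _ < _) _).
move: (ln pv) (ln pu) => a b IH htr hround.
have s0 : 0 < s by rewrite divr_gt0 //; move: a0; lra.
have k0 : 0 <= 2 * eta / s by rewrite !mulr_ge0 // ?invr_ge0 ltW.
have : 2 * eta / s * (4 * eta * expR 2 * tr) <= 2 * eta / s * (32 * eta * expR 2 * (l2 - l1)).
  rewrite ler_wpM2l //.
  have -> : 32 * eta * expR 2 * (l2 - l1) = 4 * eta * expR 2 * (8 * (l2 - l1)) by ring.
  by rewrite ler_wpM2l // !mulr_ge0 ?expR_ge0 // ltW.
move: (2 * eta / s) hround IH k0 => K hround IH k0 htr'.
apply: le_trans hround _.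
apply: le_trans (lerD IH (lexx _)) _.
rewrite -subr_ge0; rewrite -subr_ge0 in htr'.
apply: le_trans htr' _; rewrite le_eqVlt; apply/orP; left; apply/eqP; ring.
Qed.

(** Each covariance has diagonal entries at most 1, so those of the matrix are at most
    [lambda + n <= lambda * n.+1]. After Hadamard's inequality, [lambda ^+ d] cancels with the
    initial determinant. *)
Lemma ln_det_design n : (n < T)%N ->
  ln (\det (design n.+1)) - ln (\det (design 1)) <= d%:R * ln (n.+1)%:R.
Proof.
move=> nT; have hn : form_ge lambda (design n.+1) := design_form_ge _.
have diag i : design n.+1 i i <= lambda * n.+1%:R.
  rewrite !mxE eqxx mulr1n summxE.
  apply: le_trans (_ : lambda + \sum_(1 <= t < n.+1 | U t) 1 <= _).
    rewrite lerD2l; apply: ler_sum => t Ut.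
    have := mnl_cov_le_id (S t) (w t.+1) (delta_mx i 0) (x1 Ut).
    have -> : dotv (delta_mx i 0) (delta_mx i 0 : 'cV[R]_d) = 1.
      rewrite dotvE (bigD1 i) //= !mxE !eqxx mulr1 big1 ?addr0 // => j ji.
      by rewrite !mxE (negPf ji) mul0r.
    apply: le_trans; rewrite dotvE (bigD1 i) //= [delta_mx _ _ _ _]mxE !eqxx mul1r.
    rewrite big1 ?addr0; last by move=> j ji; rewrite [delta_mx _ _ _ _]mxE (negPf ji) mul0r.
    rewrite [(_ *m _) _ _]mxE (bigD1 i) //= [delta_mx _ _ _ _]mxE !eqxx mulr1.
    by rewrite big1 ?addr0 // => j ji; rewrite [delta_mx _ _ _ _]mxE (negPf ji) mulr0.
  apply: le_trans (_ : lambda + \sum_(1 <= t < n.+1) 1 <= _).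
    by rewrite lerD2l [leLHS]big_mkcond ler_sum // => t _; case: ifP.
  rewrite sumr_const_nat subn1 /= -natr1 mulrDr mulr1 addrC lerD2r.
  by rewrite -[leLHS]mul1r ler_wpM2r.
have := form_ge_det_le lambda0 hn diag.
have dn := form_ge_det_gt0 lambda0 hn.
have n0 : 0 < n.+1%:R :> R by [].
rewrite -ler_ln ?posrE ?exprn_gt0 ?mulr_gt0 // design1 det_scalar.
rewrite !lnXn ?mulr_gt0 // lnM ?posrE // mulrnDl.
by rewrite -[ln n.+1%:R *+ d]mulr_natl; lra.
Qed.

Lemma trajectory_norm_bound n (B delta : R) : (n < T)%N -> 0 < delta ->
  norm2 (w 1%N) <= B -> norm2 u <= B ->
  \prod_(1 <= t < n.+1) tilt_factor t (c t) < delta^-1 ->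
  dotv (w n.+1 - u) (design n.+1 *m (w n.+1 - u)) <=
  4 * B ^+ 2 * lambda + 2 * eta / s *
     (- ln delta + 32 * eta * expR 2 * (d%:R * ln (n.+1)%:R)).
Proof.
move=> nT delta0 wB uB hp; apply: le_trans (trajectory_bound (ltnW nT)) _.
have s0 : 0 < s by rewrite divr_gt0 //; move: a0; lra.
apply: lerD.
  rewrite design1 mul_scalar_mx dotvZr mulrC ler_wpM2r ?(ltW lambda0) //.
  have B2 (y : 'cV[R]_d) : norm2 y <= B -> dotv y y <= B ^+ 2.
    by move=> yB; rewrite -norm2_sqr lerXn2r ?nnegrE ?norm2_ge0 // (le_trans _ yB) ?norm2_ge0.
  (* The parallelogram law bounds the squared distance by twice the sum of the squared norms, whence
     [4 * B ^+ 2]. *)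
  have := B2 _ wB; have := B2 _ uB; have := dotv_ge0 (w 1%N + u).
  by rewrite !dotvBl !dotvBr !dotvDl !dotvDr (dotvC u (w 1%N)); lra.
rewrite ler_wpM2l ?mulr_ge0 ?invr_ge0 ?(ltW s0) ?(ltW eta0) //.
apply: lerD.
  rewrite -lnV ?posrE // ler_ln ?posrE ?invr_gt0 ?(ltW hp) //.
  by apply: prodr_gt0 => t _; exact: tilt_factor_gt0.
by rewrite ler_wpM2l ?mulr_ge0 ?expR_ge0 ?(ltW eta0) // ln_det_design.
Qed.

End Trajectory.

(** * The constant of the rate *)

Section Constants.
Variable R : realType.

(** For [alpha0 <= alpha] the three factors bound [2 * eta / alpha], [(1 + alpha) / alpha] and, per
    unit of [alpha * X], the bracket in [rate_bound]. *)
Definition rate_constant (alpha0 : R) : R :=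
  (alpha0^-1 + 17 / 4) * (1 + alpha0^-1) *
  (alpha0^-1 + 16 * expR 2 * (alpha0^-1 + 17 / 4)).

Lemma rate_constant_ge0 a : 0 < a -> 0 <= rate_constant a.
Proof.
move=> a0; have i0 : 0 < a^-1 by rewrite invr_gt0.
have e0 := expR_gt0 (2 : R).
by rewrite /rate_constant !mulr_ge0 ?addr_ge0 ?mulr_ge0 ?addr_ge0 ?ltW // divr_ge0.
Qed.

Lemma rate_bound (alpha0 alpha eta L M : R) (X : R) : 0 < alpha0 -> alpha0 <= alpha ->
  0 < eta -> 2 * eta <= 1 + 17 / 4 * alpha -> 0 <= L -> L <= X -> 0 <= M -> M <= X ->
  2 * eta / (alpha / (1 + alpha)) * (L + 32 * eta * expR 2 * M)
  <= rate_constant alpha0 * (alpha ^+ 2 * X).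
Proof.
move=> a0 aa e0 e1 L0 LX M0 MX; have al0 : 0 < alpha by apply: lt_le_trans aa.
have E0 := expR_gt0 (2 : R).
pose i := alpha0^-1; have i0 : 0 < i by rewrite invr_gt0.
have ia : 1 <= i * alpha by rewrite /i mulrC ler_pdivlMr // mul1r.
have X0 : 0 <= X by apply: le_trans LX.
have h1 : 2 * eta <= (i + 17 / 4) * alpha by lra.
have h2 : (alpha / (1 + alpha))^-1 <= 1 + i.
  rewrite invf_div mulrDl divff ?gt_eqF // mul1r addrC lerD2l.
  by rewrite lef_pV2 ?posrE.
have h3 : L + 32 * eta * expR 2 * M <= (i + 16 * expR 2 * (i + 17 / 4)) * (alpha * X).
  have -> : (i + 16 * expR 2 * (i + 17 / 4)) * (alpha * X)
    = i * alpha * X + 16 * expR 2 * ((i + 17 / 4) * alpha * X) by ring.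
  have -> : 32 * eta * expR 2 * M = 16 * expR 2 * (2 * eta * M) by ring.
  apply: lerD; first by apply: le_trans LX _; rewrite ler_peMl.
  rewrite ler_pM2l ?mulr_gt0 //.
  by apply: ler_pM => //; rewrite mulr_ge0 // ltW.
rewrite (_ : rate_constant alpha0 * (alpha ^+ 2 * X) =
   (i + 17 / 4) * alpha * (1 + i) * ((i + 16 * expR 2 * (i + 17 / 4)) * (alpha * X))); last first.
  by rewrite /rate_constant -/i; ring.
have s0 : 0 <= (alpha / (1 + alpha))^-1.
  by rewrite invr_ge0 divr_ge0 ?(ltW al0) // addr_ge0 // ltW.
apply: ler_pM => //.
- by rewrite mulr_ge0 // mulr_ge0 // ltW.
- by rewrite addr_ge0 // !mulr_ge0 // ltW.
by apply: ler_pM => //; rewrite mulr_ge0 // ltW.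
Qed.

End Constants.

(** * Adaptedness and the theorem *)

Section Adapted.
Variables (disp : measure_display) (Omega : measurableType disp) (R : realType).
Variables (F : nat -> set (set Omega)) (d N T : nat).
Variables (x : nat -> Omega -> 'I_N -> 'cV[R]_d) (S : nat -> Omega -> {set 'I_N}).
Variables (U : nat -> Omega -> bool) (w w' : nat -> Omega -> 'cV[R]_d).
Variables (u : 'cV[R]_d) (alpha eta lambda : R).
Hypothesis lambda0 : 0 < lambda.
Hypothesis filtF : filtration F.
Hypothesis x_pred : forall t, (1 <= t <= T)%N -> forall i,
  meas_vec (F t.-1) (fun omega => x t omega i).
Hypothesis S_pred : forall t, (1 <= t <= T)%N -> meas_discrete (F t.-1) (S t).
Hypothesis U_pred : forall t, (1 <= t <= T)%N -> meas_discrete (F t.-1) (U t).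
Hypothesis w_adapted : forall t, (1 <= t <= T.+1)%N -> meas_vec (F t.-1) (w t).
Hypothesis w'_pred : forall t, (1 <= t <= T)%N -> meas_vec (F t.-1) (w' t).

Let GT n := g_sigma_algebraType (F n).
Let sF n : sigma_algebra setT (F n). Proof. by case: filtF. Qed.
Let FS m n : (m <= n)%N -> F m `<=` F n. Proof. by case: filtF => _ _; exact. Qed.

Lemma meas_vec_mx m n (f : Omega -> 'cV[R]_d) : (m <= n)%N -> meas_vec (F m) f ->
  meas_mx (f : GT n -> 'cV[R]_d).
Proof.
move=> mn mf i j; rewrite (ord1 j); apply/(meas_realP (sF n)) => A mA.
by apply: (FS mn); exact: mf.
Qed.

Lemma meas_discrete_set m n (I : finType) (f : Omega -> I) : (m <= n)%N ->
  meas_discrete (F m) f -> forall a, measurable ([set t | f t = a] : set (GT n)).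
Proof.
by move=> mn mf; apply: (meas_discreteP (sF n)) => a; apply: (FS mn); exact: mf.
Qed.

Lemma meas_bool m n (f : Omega -> bool) : (m <= n)%N -> meas_discrete (F m) f ->
  measurable_fun setT (f : GT n -> bool).
Proof.
move=> mn mf; exact: (@measurable_fun_discrete _ (GT n) _ _ _ f id (meas_discrete_set mn mf)).
Qed.

Let design_at omega := design (x ^~ omega) (S ^~ omega) (U ^~ omega) (w ^~ omega) lambda.

(** The covariance added at round [n.+1] sits at the iterate [w n.+2], known once the choice of that
    round is; measurability therefore moves from [F n] to [F n.+1]. *)
Lemma meas_design n : (n <= T)%N -> meas_mx (fun omega : GT n => design_at omega n.+1).
Proof.
elim: n => [_|n IH nT]; rewrite /design_at.
  by under eq_fun do rewrite design1; exact: meas_mx_cst.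
have nT' : (1 <= n.+1 <= T)%N by [].
move=> i j; under eq_fun do rewrite designS (fun_if (fun M : 'M[R]_d => M i j)).
have mD : meas_mx (fun omega : GT n.+1 => design_at omega n.+1).
  move=> i' j'; apply/(meas_realP (sF n.+1)) => A mA; apply: (FS (leqnSn n)).
  by have /(meas_realP (sF n)) := IH (ltnW nT) i' j'; apply.
apply: measurable_fun_ifT; last exact: mD.
  exact: meas_bool (leqnSn n) (U_pred nT').
apply: meas_mxD => //; apply: meas_mnl_cov.
- by move=> i'; exact: meas_vec_mx (leqnSn n) (x_pred nT' i').
- exact: meas_discrete_set (leqnSn n) (S_pred nT').
- by apply: (@meas_vec_mx n.+1) => //; exact: (w_adapted (t := n.+2)).
Qed.

Lemma tilt_factor_predictable t : (1 <= t <= T)%N -> forall o, meas_real (F t.-1)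
  (fun omega => tilt_factor (x ^~ omega) (S ^~ omega) (U ^~ omega) (w ^~ omega) (w' ^~ omega)
                  u alpha eta lambda t o).
Proof.
case: t => // n tT o; apply/(meas_realP (sF n)); rewrite /tilt_factor.
have mx i : meas_mx (fun omega : GT n => x n.+1 omega i).
  exact: meas_vec_mx (leqnn n) (x_pred tT i).
have mS := meas_discrete_set (leqnn n) (S_pred tT).
have mw2 : meas_mx (fun omega : GT n => w' n.+1 omega).
  exact: meas_vec_mx (leqnn n) (w'_pred tT).
have mD : meas_mx (fun omega : GT n => design_at omega n.+1) by apply: meas_design; exact: ltnW tT.
have mscore o' : measurable_fun setT (fun omega : GT n =>
    score_norm (x n.+1 omega) (S n.+1 omega) (design_at omega n.+1) (w' n.+1 omega) o').
  apply: (measurable_invform lambda0) => //.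
    by move=> omega; exact: design_form_ge.
  by apply: meas_mxB; [exact: meas_mnl_mean|exact: meas_feature].
have mtrace : measurable_fun setT (fun omega : GT n =>
    score_trace (x n.+1 omega) (S n.+1 omega) (design_at omega n.+1) (w' n.+1 omega)).
  apply: measurable_sum_cond => o'; first exact: measurable_offered.
  by apply: measurable_funM => //; exact: measurable_mnl_prob.
have mtilted : meas_mx (fun omega : GT n => tilted (w' ^~ omega) u alpha n.+1).
  apply: meas_mxD; first exact: meas_mx_cst.
  apply: meas_mxZ; first exact: measurable_cst.
  by apply: meas_mxB => //; exact: meas_mx_cst.
apply: measurable_fun_ifT; last exact: measurable_cst.
  exact: meas_bool (leqnn n) (U_pred tT).
apply: measurable_funM.
  apply: measurable_funM; first exact: measurable_mnl_prob.
  apply: measurable_inv; first by move=> omega; exact: mnl_prob_gt0.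
  by apply: measurable_mnl_prob => //; exact: meas_mx_cst.
apply: measurableT_comp; first exact: measurable_expR.
by apply: measurable_funB; apply: measurable_funM => //; exact: measurable_cst.
Qed.

Lemma meas_form t : (1 <= t <= T)%N -> measurable_fun setT (fun omega =>
  dotv (w t omega - u) (design_at omega t *m (w t omega - u))).
Proof.
case: t => // n tT.
have Fm : F n `<=` measurable by case: filtF.
apply: (meas_real_measurable Fm); apply/(meas_realP (sF n)).
have mw : meas_mx (fun omega : GT n => w n.+1 omega - u).
  apply: meas_mxB; last exact: meas_mx_cst.
  by apply: (@meas_vec_mx n) => //; apply: (w_adapted (t := n.+1)); exact: leqW tT.
apply: measurable_dotv => //; apply: meas_mxM => //.
by apply: meas_design; exact: ltnW tT.
Qed.

End Adapted.

Unset Implicit Arguments.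

Theorem theorem4p2 (R : realType) (alpha0 : R) (halpha0 : 0 < alpha0) :
  exists C : R, 0 < C /\
  forall (disp : measure_display) (Omega : measurableType disp)
    (P : probability Omega R) (F : nat -> set (set Omega))
    (d N K T : nat)
    (x : nat -> Omega -> 'I_N -> 'cV[R]_d) (r : nat -> Omega -> 'I_N -> R)
    (S : nat -> Omega -> {set 'I_N}) (c : nat -> Omega -> option 'I_N)
    (wstar : 'cV[R]_d) (U : nat -> Omega -> bool)
    (W : nat -> Omega -> set 'cV[R]_d) (w w' : nat -> Omega -> 'cV[R]_d)
    (delta alpha B : R),
  0 < delta <= 1 ->
  0 < alpha -> alpha0 <= alpha ->
  let eta := (1 + 3 * Num.sqrt 2 * alpha) / 2 in
  let lambda :=
    Num.max (72 * eta * alpha) (Num.max (144 * eta * d%:R) 2) in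
  let ell := fun t omega => mnl_loss (x t omega) (S t omega) (c t omega) in
  mnl_model P F K T x r S c wstar ->
  occasional_omd F T eta lambda B U ell W w w' ->
  (forall t, (1 <= t <= T)%N -> forall omega i, norm2 (x t omega i) <= 1) ->
  (forall t, (1 <= t <= T)%N -> forall omega i, 0 <= r t omega i <= 1) ->
  norm2 wstar <= B ->
  (forall t omega, U t omega ->
    [/\ compact (W t omega),
        convex_set (W t omega : set (convex_lmodType 'cV[R]_d)),
        W t omega wstar
      & forall i, i \in S t omega ->
          (ereal_sup [set `|dotv (x t omega i) (v - wstar)|%:E
                     | v in W t omega] <= alpha%:E)%E]) ->
  ((1 - delta)%:E <=
    P [set omega | (forall t, U t omega ->
        mxnorm (omd_matrix lambda (U ^~ omega) (ell ^~ omega) (w ^~ omega) t)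
          (w t omega - wstar)
        <= C * (alpha * Num.sqrt (d%:R * ln (t%:R / delta))
                + B * Num.sqrt lambda))%R])%E.
Proof.
(* The 2 is the root of the factor in [4 * B ^+ 2 * lambda]; the other root comes from the
   stochastic term. *)
exists (2 + Num.sqrt (rate_constant alpha0)); split.
  by rewrite ltr_pwDl // sqrtr_ge0.
move=> disp Omega P F d N K T x r S c u U W w w' delta alpha B.
move=> /andP[delta0 delta1] al0 al1 eta lambda ell model omd x1 _ uB hW.
have B0 : 0 <= B by apply: le_trans uB; exact: norm2_ge0.
have rc0 := rate_constant_ge0 halpha0.
set C := 2 + _; have C0 : 0 <= C by rewrite addr_ge0 ?sqrtr_ge0.
pose b t : R := C * (alpha * Num.sqrt (d%:R * ln (t%:R / delta)) + B * Num.sqrt lambda).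
have b0 t : 0 <= b t.
  by rewrite mulr_ge0 // addr_ge0 // mulr_ge0 ?sqrtr_ge0 // ltW.
(* For [d = 0] the bound [144 * eta <= lambda] may fail, but every vector is zero. *)
have [d0|d0] := posnP d.
  rewrite (_ : mkset _ = setT); last first.
    apply/seteqP; split=> // omega _ t _; apply: le_trans (b0 t).
    rewrite mxnormE dotvE big1 ?sqrtr0 // => i _.
    by have := ltn_ord i; rewrite {2}d0.
  by rewrite probability_setT lee_fin lerBlDr lerDl ltW.
have sq2 : Num.sqrt 2 ^+ 2 = 2 :> R by rewrite sqr_sqrtr.
have sq0 : 0 <= Num.sqrt 2 :> R by exact: sqrtr_ge0.
(* Three times the rational bounds [7 / 5] and [17 / 12] on [Num.sqrt 2] give [21 / 5] and
   [17 / 4]. *)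
have eta_lb : 1 + 21 / 5 * alpha <= 2 * eta.
  have : 7 / 5 <= Num.sqrt 2 :> R by nra.
  by rewrite /eta => h; have := ler_wpM2r (ltW al0) h; lra.
have eta_ub : 2 * eta <= 1 + 17 / 4 * alpha.
  have : Num.sqrt 2 <= 17 / 12 :> R by nra.
  by rewrite /eta => h; have := ler_wpM2r (ltW al0) h; lra.
have eta0 : 0 < eta by lra.
have lb1 : 72 * eta * alpha <= lambda by rewrite /lambda le_max lexx.
have lb2 : 144 * eta <= lambda.
  rewrite /lambda !le_max; apply/orP; right; apply/orP; left.
  by apply: ler_peMr; [rewrite mulr_ge0 // ltW|rewrite ler1n].
have lambda0 : 0 < lambda by apply: lt_le_trans lb2; rewrite mulr_gt0.
have rounds t omega : U t omega -> (1 <= t <= T)%N by exact: (omd_rounds omd).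
have off omega t : U t omega -> offered (S t omega) (c t omega).
  by move=> /rounds h; exact: (mnl_choice_offered model).
have x1' omega t : U t omega -> forall i, norm2 (x t omega i) <= 1.
  by move=> /rounds h; exact: x1.
have cW omega t : U t omega -> convex_set (W t omega : set (convex_lmodType 'cV[R]_d)).
  by move=> /hW[].
have Wu omega t : U t omega -> W t omega u by move=> /hW[].
have W_le omega t : U t omega -> forall v, W t omega v -> forall o, offered (S t omega) o ->
    `|dotv (feature (x t omega) o) (v - u)| <= alpha.
  move=> /hW[_ _ _ h] v Wv [i|] /= So; last by rewrite dotv0l normr0 ltW.
  by rewrite -lee_fin; apply: le_trans (h i So); apply: ereal_sup_ubound; exists v.
pose Z t o omega := tilt_factor (x ^~ omega) (S ^~ omega) (U ^~ omega) (w ^~ omega) (w' ^~ omega)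
                  u alpha eta lambda t o.
pose q t o omega : R := if offered (S t omega) o
                    then mnl_prob (x t omega) (S t omega) u o else 0.
have q_sum t omega (f : option 'I_N -> R) : \sum_o q t o omega * f o =
    \sum_(o | offered (S t omega) o) mnl_prob (x t omega) (S t omega) u o * f o.
  by rewrite [RHS]big_mkcond; apply: eq_bigr => o _; rewrite /q; case: ifP; rewrite ?mul0r.
have filtF := mnl_filtration model.
have Zpred := tilt_factor_predictable u alpha eta lambda0 filtF (mnl_features_predictable model)
  (mnl_assortment_predictable model) (omd_rounds_predictable omd) (omd_iterates_adapted omd)
  (omd_projection_predictable omd).
(* Ville's inequality at level [delta^-1], for a failure probability of at most [delta]. *)
have [mgood Pgood] : measurable [set omega | stopped_product c Z delta^-1 T omega < delta^-1] /\
    ((1 - delta^-1^-1)%:E <=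
       P [set omega | (stopped_product c Z delta^-1 T omega < delta^-1)%R])%E.
  apply: (@ville _ _ _ P F T _ c q Z _ filtF).
  - exact: mnl_choice_adapted model.
  - by move=> t tT o; exact: (mnl_choice_law model tT o).
  - by move=> t o omega; rewrite /q; case: ifP => // _; exact: mnl_prob_ge0.
  - move=> t omega _; under eq_bigr do rewrite -[q _ _ _]mulr1.
    by rewrite q_sum; under eq_bigr do rewrite mulr1; rewrite mnl_prob_sum.
  - by move=> t o omega; exact/ltW/tilt_factor_gt0.
  - exact: Zpred.
  - move=> t omega tT; rewrite q_sum.
    apply: (tilt_factor_mass_le1 (off omega) (x1' omega) al0 eta_lb lb2 (W_le omega) (T := T)) => //.
    by move=> t' tT'; exact: (omd_update omd tT' omega).
  - by rewrite invr_gt0.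
rewrite invrK in Pgood; apply: le_trans Pgood _.
have mxE omega t : mxnorm (omd_matrix lambda (U ^~ omega) (ell ^~ omega) (w ^~ omega) t)
          (w t omega - u) <= b t <->
   dotv (w t omega - u) (design (x ^~ omega) (S ^~ omega) (U ^~ omega) (w ^~ omega) lambda t
      *m (w t omega - u)) <= b t ^+ 2.
  rewrite (omd_matrixE (x ^~ omega) (w ^~ omega) lambda (off omega) t) mxnormE.
  set D := design _ _ _ _ _ _.
  have q0 : 0 <= dotv (w t omega - u) (D *m (w t omega - u)).
    by apply: form_ge_ge0 (ltW lambda0) _; exact: design_form_ge.
  by rewrite -(@ler_pXn2r _ 2 _ (Num.sqrt _)) ?nnegrE ?sqrtr_ge0 // sqr_sqrtr.
apply: le_measure; rewrite ?inE //.
  (* Monotonicity of [P] requires the target event to be measurable: it is a countable intersection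
     over rounds, trivial outside 1, ..., [T]. *)
  rewrite (_ : mkset _ = \bigcap_t (if (1 <= t <= T)%N then
     [set omega | U t omega ==> (dotv (w t omega - u) (design (x ^~ omega) (S ^~ omega)
       (U ^~ omega) (w ^~ omega) lambda t *m (w t omega - u)) <= b t ^+ 2)] else setT)).
    apply: bigcapT_measurable => t; case: ifP => // tT.
    have Ft : F t.-1 `<=` measurable by case: filtF.
    have mU : measurable_fun setT (U t).
      apply: (@measurable_fun_discrete _ Omega _ _ _ (U t) id) => a; apply: Ft.
      exact: (omd_rounds_predictable omd tT).
    have mf := meas_form u lambda filtF (mnl_features_predictable model)
      (mnl_assortment_predictable model) (omd_rounds_predictable omd)
      (omd_iterates_adapted omd) tT.
    have mle := measurable_fun_ler mf (measurable_cst (b t ^+ 2)).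
    have := measurable_fun_ifT mU mle (measurable_cst true).
    have mt : measurable [set true] by [].
    move=> /(_ measurableT _ mt); rewrite setTI.
    congr (measurable _); apply/seteqP; split=> omega /=; by case: (U t omega).
  apply/seteqP; split=> [omega h t _|omega h t Ut].
    by case: ifP => // _ /=; apply/implyP => Ut; apply/mxE/h.
  have := h t I; rewrite (rounds _ _ Ut) /= Ut /=.
  by move/mxE.
(* On the good event every partial product stays below [delta^-1]; the bound at round [n.+1] uses
   the first [n] factors. *)
move=> omega /= /stopped_product_lt[_ hprod] t Ut; apply/mxE.
have := rounds _ _ Ut; case: t Ut => // n Ut /andP[_ nT].
have := trajectory_norm_bound (off omega) (x1' omega) al0 eta_lb eta_ub lb1 lb2 (cW omega)
  (Wu omega) (W_le omega) (fun t tT => omd_update omd tT omega) nT delta0 (omd_initial omd omega) uB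
  (hprod n (ltnW nT)).
move=> h; apply: le_trans h _.
pose X : R := d%:R * ln (n.+1%:R / delta).
have n0 : 0 < n.+1%:R :> R by [].
have lnE : ln (n.+1%:R / delta) = ln n.+1%:R - ln delta.
  by rewrite ln_div ?posrE.
have L0 : 0 <= - ln delta by rewrite oppr_ge0 ln_le0.
have M0 : 0 <= ln n.+1%:R :> R by rewrite ln_ge0 // ler1n.
have d1 : 1 <= d%:R :> R by rewrite ler1n.
(* Here [d >= 1] lets the confidence term be absorbed into [X]. *)
have X1 : - ln delta <= X.
  rewrite /X lnE; apply: le_trans (_ : 1 * (ln n.+1%:R - ln delta) <= _).
    by rewrite mul1r lerDr.
  by rewrite ler_wpM2r // addr_ge0.
have X2 : d%:R * ln n.+1%:R <= X by rewrite /X lnE ler_wpM2l // lerDl.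
have X0 : 0 <= X by apply: le_trans X1.
have := rate_bound halpha0 al1 eta0 eta_ub L0 X1 (mulr_ge0 (le_trans ler01 d1) M0) X2.
move=> rate; apply: le_trans (lerD (lexx _) rate) _.
rewrite /b -/X /C; set rt := Num.sqrt (rate_constant _).
have rtE : rate_constant alpha0 = rt ^+ 2 by rewrite sqr_sqrtr.
have rt0 : 0 <= rt by exact: sqrtr_ge0.
have XE : X = Num.sqrt X ^+ 2 by rewrite sqr_sqrtr.
have lE : lambda = Num.sqrt lambda ^+ 2 by rewrite sqr_sqrtr // ltW.
rewrite rtE {1}XE {1}lE.
have sX : 0 <= Num.sqrt X by exact: sqrtr_ge0.
have sl : 0 <= Num.sqrt lambda by exact: sqrtr_ge0.
move: (Num.sqrt X) (Num.sqrt lambda) sX sl => y z y0 z0.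
have p0 : 0 <= alpha * y by rewrite mulr_ge0 // ltW.
have p1 : 0 <= B * z by rewrite mulr_ge0.
have -> : 4 * B ^+ 2 * z ^+ 2 + rt ^+ 2 * (alpha ^+ 2 * y ^+ 2)
  = (2 * (B * z)) ^+ 2 + (rt * (alpha * y)) ^+ 2 by ring.
have p2 : 0 <= rt * (B * z) by rewrite mulr_ge0.
have p3 : 0 <= rt * (alpha * y) by rewrite mulr_ge0.
apply: le_trans (_ : (2 * (B * z) + rt * (alpha * y)) ^+ 2 <= _).
  by rewrite sqrrD -addrA lerD2l lerDr mulrn_wge0 // mulr_ge0 // mulr_ge0.
rewrite lerXn2r ?nnegrE ?addr_ge0 ?mulr_ge0 ?addr_ge0 //.
  exact: ltW.
lra.
Qed.
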